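(* Let $X,U,V$ be Banach spaces, let $A:D(A)\subset X\to X$ generate a $C_0$-semigroup $T=(T(t))_{t\ge 0}$ on $X$, let $B\in L(U,X_{-1})$, $B_2\in L(V,X_{-1})$ and $f:X\times U\to V$. Assume: (a) $B$ is $\infty$-admissible for $T$, and the map $(t,u)\mapsto \Phi(t)u:=\int_0^tT_{-1}(t-s)Bu(s)\,ds$ is continuous from $\mathbb{R}_+\times L^\infty(\mathbb{R}_+,U)$ to $X$; (b) $B_2$ is zero-class $\infty$-admissible for $T$, and for all $u\in L^\infty(\mathbb{R}_+,U)$ and all $x\in C(\mathbb{R}_+,X)$ the map $s\mapsto f(x(s),u(s))$ is in $L^\infty_{loc}(\mathbb{R}_+,V)$; (c) for every $C>0$ there is $L(C)>0$ with $\|f(y,v)-f(x,v)\|_V\le L(C)\|y-x\|_X$ for all $x,y\in X$ with $\|x\|_X,\|y\|_X<C$ and all $v\in U$ with $\|v\|_U<C$; $f(x,\cdot)$ is continuous for every $x\in X$; and there are $\sigma\in\mathcal{K}_\infty$, $c>0$ with $\|f(0,u)\|_V\le\sigma(\|u\|_U)+c$ for all $u\in U$. Then the system $$\dot x(t)=Ax(t)+B_2f(x(t),u(t))+Bu(t),\qquad x(0)=x_0,$$ is well-posed: for every $x_0\in X$ and every $u\in L^\infty(\mathbb{R}_+,U)$ there exists a unique maximal mild solution $\phi(\cdot,x_0,u):[0,t_m(x_0,u))\to X$, where $0<t_m(x_0,u)\le\infty$.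
   Context: $\mathcal{K}_\infty$ is the set of continuous, strictly increasing, unbounded $\gamma:\mathbb{R}_+\to\mathbb{R}_+$ with $\gamma(0)=0$. $X_{-1}$ is the completion of $X$ in the norm $x\mapsto\|(aI-A)^{-1}x\|_X$ with some $a\in\rho(A)$ (different $a$ give equivalent norms); $T$ extends uniquely to a $C_0$-semigroup $T_{-1}=(T_{-1}(t))_{t\ge0}$ on $X_{-1}$. $L^\infty_{loc}(\mathbb{R}_+,Y)$: strongly measurable functions $\mathbb{R}_+\to Y$ that are essentially bounded on every $[0,t]$. An operator $B\in L(U,X_{-1})$ is $\infty$-admissible for $T$ if there is $t>0$ such that $\int_0^tT_{-1}(t-s)Bu(s)\,ds\in X$ for all $u\in L^\infty_{loc}(\mathbb{R}_+,U)$. Equivalently (known fact), for every $t>0$ there is $h_t>0$ such that for all $u\in L^\infty_{loc}(\mathbb{R}_+,U)$ this integral lies in $X$ and $\|\int_0^tT_{-1}(t-s)Bu(s)\,ds\|_X\le h_t\|u\|_{L^\infty([0,t],U)}$; $t\mapsto h_t$ is assumed (without loss of generality) nondecreasing. $B$ is zero-class $\infty$-admissible if the constants can be chosen with $\lim_{t\to+0}h_t=0$. The same definitions apply to $B_2$ with $V$ in place of $U$. A mild solution on $[0,\tau]$ is a function $x\in C([0,\tau],X)$ such that for all $t\in[0,\tau]$ $$x(t)=T(t)x_0+\int_0^tT_{-1}(t-s)B_2f(x(s),u(s))\,ds+\int_0^tT_{-1}(t-s)Bu(s)\,ds,$$ with Bochner integrals of $X_{-1}$-valued maps. A function on $[0,t_1)$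 is a mild solution if its restriction to $[0,\tau]$ is one for every $\tau\in(0,t_1)$. A mild solution $x_2$ on $[0,t_2)$ extends a mild solution $x_1$ on $[0,t_1)$ if $t_2>t_1$ and $x_2=x_1$ on $[0,t_1)$. A solution is maximal if no solution (for the same $x_0,u$) extends it. *)

(* Defs.v *)
From HB Require Import structures.
From mathcomp Require Import all_boot all_order all_algebra.
From mathcomp Require Import all_classical all_reals all_analysis ess_sup_inf.
Set Implicit Arguments.
Unset Strict Implicit.
Unset Printing Implicit Defensive.
Import Order.TTheory GRing.Theory Num.Theory.
Import numFieldNormedType.Exports.
Local Open Scope classical_set_scope.
Local Open Scope ring_scope.

(* Functions of time t >= 0 are total functions on R
   of which only the values at t >= 0 are used; elements of L^oo are handled
   through representatives. *)

Definition Kinfty (R : realType) (g : R -> R) : Prop :=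
  [/\ g 0 = 0,
      {within `[0, +oo[, continuous g},
      {in `[0, +oo[ &, {homo g : r s / r < s}} &
      forall M : R, exists2 r, 0 <= r & M < g r].

Definition simple_fun (R : realType) (Y : completeNormedModType R)
    (s : R -> Y) : Prop :=
  finite_set (range s) /\
  forall y : Y, measurable (s @^-1` [set y] : set (measurableTypeR R)).

(* On [a, b] every level set has finite measure, so [fine] loses nothing. *)
Definition simple_integral (R : realType) (Y : completeNormedModType R)
    (a b : R) (s : R -> Y) : Y :=
  \sum_(y \in range s)
    fine (lebesgue_measure (`[a, b] `&` s @^-1` [set y])) *: y.

(* [bochner_integral a b f v]: f is Bochner integrable on [a, b], with
   integral v. *)
Definition bochner_integral (R : realType) (Y : completeNormedModType R)
    (a b : R) (f : R -> Y) (v : Y) : Prop :=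
  exists s : nat -> R -> Y,
    [/\ forall n, simple_fun (s n),
        {ae lebesgue_measure, forall r : R, r \in `[a, b] ->
           s n r @[n --> \oo] --> f r},
        (\int[lebesgue_measure]_(r in `[a, b]) (`|f r - s n r|%:E))%E
           @[n --> \oo] --> 0%E &
        simple_integral a b (s n) @[n --> \oo] --> v].

Definition strongly_measurable (R : realType) (Y : completeNormedModType R)
    (u : R -> Y) : Prop :=
  exists2 s : nat -> R -> Y, forall n, simple_fun (s n) &
    {ae lebesgue_measure, forall r : R, 0 <= r ->
       s n r @[n --> \oo] --> u r}.

Definition Linf_norm (R : realType) (Y : completeNormedModType R)
    (D : set R) (u : R -> Y) : \bar R :=
  ess_sup lebesgue_measure (EFin \o ((fun r => `|u r|) \_ D)).

Definition Linf (R : realType) (Y : completeNormedModType R)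
    (u : R -> Y) : Prop :=
  strongly_measurable u /\ (Linf_norm `[0%R, +oo[ u < +oo)%E.

Definition Linf_loc (R : realType) (Y : completeNormedModType R)
    (u : R -> Y) : Prop :=
  strongly_measurable u /\
  forall t : R, 0 <= t -> (Linf_norm `[0%R, t] u < +oo)%E.

Definition C0_semigroup (R : realType) (X : completeNormedModType R)
    (T : R -> {linear X -> X}) : Prop :=
  [/\ forall t, 0 <= t -> continuous (T t),
      forall x, T 0 x = x,
      forall s t x, 0 <= s -> 0 <= t -> T (s + t) x = T s (T t x) &
      forall x, T t x @[t --> 0^'+] --> x].

(* An unbounded operator A : D(A) -> X is given by its domain [D] and a total
   function [A] whose values outside D are irrelevant. *)
Definition generates (R : realType) (X : completeNormedModType R)
    (D : set X) (A : X -> X) (T : R -> {linear X -> X}) : Prop :=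
  C0_semigroup T /\
  forall x,
    (D x <-> cvg (t^-1 *: (T t x - x) @[t --> 0^'+])) /\
    (D x -> t^-1 *: (T t x - x) @[t --> 0^'+] --> A x).

(* a is in rho(A), and Ra = (aI - A)^-1. *)
Definition is_resolvent (R : realType) (X : completeNormedModType R)
    (D : set X) (A : X -> X) (a : R) (Ra : {linear X -> X}) : Prop :=
  [/\ continuous Ra,
      forall x, D (Ra x) /\ a *: Ra x - A (Ra x) = x &
      forall x, D x -> Ra (a *: x - A x) = x].

(* The complete space Xm1, with the embedding iota of X, is the completion of
   X in the norm x |-> |(aI - A)^-1 x|; this determines (Xm1, iota) up to
   isometric isomorphism. *)
Definition is_extrapolation_space (R : realType)
    (X Xm1 : completeNormedModType R) (D : set X) (A : X -> X) (a : R)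
    (iota : {linear X -> Xm1}) : Prop :=
  exists2 Ra : {linear X -> X}, is_resolvent D A a Ra &
    (forall x, `|iota x| = `|Ra x|) /\ dense (range iota).

(* Tm1 is the (unique) extension of T to a C0-semigroup on Xm1. *)
Definition is_extrapolated_semigroup (R : realType)
    (X Xm1 : completeNormedModType R) (iota : {linear X -> Xm1})
    (T : R -> {linear X -> X}) (Tm1 : R -> {linear Xm1 -> Xm1}) : Prop :=
  C0_semigroup Tm1 /\
  forall t x, 0 <= t -> Tm1 t (iota x) = iota (T t x).

(* [conv_integral Tm1 B u t v]: v is the integral over [0, t] of
   Tm1(t - s) B u(s) ds, in Xm1. *)
Definition conv_integral (R : realType) (U Xm1 : completeNormedModType R)
    (Tm1 : R -> {linear Xm1 -> Xm1}) (B : {linear U -> Xm1})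
    (u : R -> U) (t : R) (v : Xm1) : Prop :=
  bochner_integral 0 t (fun s => Tm1 (t - s) (B (u s))) v.

Definition admissible (R : realType) (U X Xm1 : completeNormedModType R)
    (iota : {linear X -> Xm1}) (Tm1 : R -> {linear Xm1 -> Xm1})
    (B : {linear U -> Xm1}) : Prop :=
  exists2 t : R, 0 < t &
    forall u, Linf_loc u -> exists x : X, conv_integral Tm1 B u t (iota x).

Definition zero_class_admissible (R : realType)
    (U X Xm1 : completeNormedModType R) (iota : {linear X -> Xm1})
    (Tm1 : R -> {linear Xm1 -> Xm1}) (B : {linear U -> Xm1}) : Prop :=
  exists h : R -> R,
    [/\ forall t, 0 < t -> 0 < h t,
        forall s t, 0 < s -> s <= t -> h s <= h t,
        forall t u, 0 < t -> Linf_loc u ->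
          exists2 x : X, conv_integral Tm1 B u t (iota x) &
            (`|x|%:E <= (h t)%:E * Linf_norm `[0%R, t] u)%E &
        h t @[t --> 0^'+] --> 0].

(* Phi(t)u, as an element of X. The default 0 is irrelevant: for admissible B
   and u in L^oo the integral lies in the range of the injection iota. *)
Definition Phi (R : realType) (U X Xm1 : completeNormedModType R)
    (iota : {linear X -> Xm1}) (Tm1 : R -> {linear Xm1 -> Xm1})
    (B : {linear U -> Xm1}) (t : R) (u : R -> U) : X :=
  xget 0 [set x | conv_integral Tm1 B u t (iota x)].

(* Joint continuity of (t, u) |-> Phi(t)u on R_+ x L^oo(R_+, U). *)
Definition Phi_continuous (R : realType) (U X Xm1 : completeNormedModType R)
    (iota : {linear X -> Xm1}) (Tm1 : R -> {linear Xm1 -> Xm1})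
    (B : {linear U -> Xm1}) : Prop :=
  forall (t : R) (u : R -> U), 0 <= t -> Linf u ->
  forall e : R, 0 < e -> exists2 d : R, 0 < d &
    forall (t' : R) (u' : R -> U), 0 <= t' -> Linf u' ->
      `|t' - t| < d -> (Linf_norm `[0%R, +oo[ (u' \- u)%R < d%:E)%E ->
      `|Phi iota Tm1 B t' u' - Phi iota Tm1 B t u| < e.

Definition mild_solution_on (R : realType) (U V X Xm1 : completeNormedModType R)
    (iota : {linear X -> Xm1}) (T : R -> {linear X -> X})
    (Tm1 : R -> {linear Xm1 -> Xm1})
    (B : {linear U -> Xm1}) (B2 : {linear V -> Xm1}) (f : X -> U -> V)
    (x0 : X) (u : R -> U) (tau : R) (x : R -> X) : Prop :=
  {within `[0, tau], continuous x} /\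
  forall t, 0 <= t <= tau -> exists v2 v : Xm1,
    [/\ conv_integral Tm1 B2 (fun s => f (x s) (u s)) t v2,
        conv_integral Tm1 B u t v &
        iota (x t) = iota (T t x0) + v2 + v].

(* Mild solution on [0, t1), with 0 < t1 <= +oo. *)
Definition mild_solution (R : realType) (U V X Xm1 : completeNormedModType R)
    (iota : {linear X -> Xm1}) (T : R -> {linear X -> X})
    (Tm1 : R -> {linear Xm1 -> Xm1})
    (B : {linear U -> Xm1}) (B2 : {linear V -> Xm1}) (f : X -> U -> V)
    (x0 : X) (u : R -> U) (t1 : \bar R) (x : R -> X) : Prop :=
  (0 < t1)%E /\
  forall tau : R, 0 < tau -> (tau%:E < t1)%E ->
    mild_solution_on iota T Tm1 B B2 f x0 u tau x.

Definition extends (R : realType) (X : completeNormedModType R)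
    (t1 : \bar R) (x1 : R -> X) (t2 : \bar R) (x2 : R -> X) : Prop :=
  (t1 < t2)%E /\ forall s : R, 0 <= s -> (s%:E < t1)%E -> x2 s = x1 s.

Definition maximal_mild_solution (R : realType)
    (U V X Xm1 : completeNormedModType R)
    (iota : {linear X -> Xm1}) (T : R -> {linear X -> X})
    (Tm1 : R -> {linear Xm1 -> Xm1})
    (B : {linear U -> Xm1}) (B2 : {linear V -> Xm1}) (f : X -> U -> V)
    (x0 : X) (u : R -> U) (t1 : \bar R) (x1 : R -> X) : Prop :=
  mild_solution iota T Tm1 B B2 f x0 u t1 x1 /\
  ~ exists t2 x2, mild_solution iota T Tm1 B B2 f x0 u t2 x2 /\
      extends t1 x1 t2 x2.

Definition well_posed (R : realType) (U V X Xm1 : completeNormedModType R)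
    (iota : {linear X -> Xm1}) (T : R -> {linear X -> X})
    (Tm1 : R -> {linear Xm1 -> Xm1})
    (B : {linear U -> Xm1}) (B2 : {linear V -> Xm1}) (f : X -> U -> V) : Prop :=
  forall (x0 : X) (u : R -> U), Linf u ->
  exists (tm : \bar R) (phi : R -> X),
    [/\ (0 < tm)%E,
        maximal_mild_solution iota T Tm1 B B2 f x0 u tm phi &
        forall (tm' : \bar R) (phi' : R -> X),
          maximal_mild_solution iota T Tm1 B B2 f x0 u tm' phi' ->
          tm' = tm /\
          forall s : R, 0 <= s -> (s%:E < tm)%E -> phi' s = phi s].

(* Main.v *)
Require Import Defs.
From HB Require Import structures.
From mathcomp Require Import all_boot all_order all_algebra.
From mathcomp Require Import ring lra.
From mathcomp Require Import all_classical all_reals all_analysis.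
From mathcomp Require Import ess_sup_inf measurable_realfun.
Set Implicit Arguments.
Unset Strict Implicit.
Unset Printing Implicit Defensive.
Import Order.TTheory GRing.Theory Num.Theory.
Import numFieldNormedType.Exports.
Local Open Scope classical_set_scope.
Local Open Scope ring_scope.

(* Write G(t)w for the integral of Tm1(t - s) B2 w(s) over [0, t] and F(t) for
   T(t)x0 + Phi(t)u.  A mild solution is a continuous solution of the Volterra
   equation x(t) = F(t) + G(t)[f(x, u)].  Zero-class admissibility bounds G(t)
   by h_t -> 0 from L^oo(0, t) to X, and through the cocycle identity
   G(t + r)w = T(r) G(t)w + G(r) w(t + .) it makes t |-> G(t)w continuous and
   makes inputs that agree on [0, t0] differ at time t by at most
   h_(t - t0) |w1 - w2|.  As f is Lipschitz on balls, Picard iteration gives a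
   solution on a short interval, and two solutions on [0, tau] agree by steps
   of a fixed length.  The maximal solution glues all solutions on intervals
   [0, tau]: it lives on [0, sup tau), so no continuation step is needed. *)

(** * Simple functions *)

(** The integrals live in [Xm1], while [f] takes its argument in [X]. Injectivity of [iota] lets
    every integral be pulled back to [X] once and for all; the Volterra argument then sees no
    integral, only estimates such as [Gdiff]. The main obstacle is the Bochner integral. An
    integrand is only an almost everywhere limit of simple functions, and measurable sets are Borel,
    so the norm of [f - s n] need not be measurable. Trading it for a Cauchy condition on the simple
    functions reduces the calculus to finite sums over level sets; the Lebesgue integral returns
    only to justify this exchange and the uniqueness of the integral. Two hypotheses are weaker than
    the argument wants. Admissibility of [B] concerns a single time, and is spread to all times by
    delaying inputs and by the cocycle identity. The input [u] is only essentially bounded, so the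
    Lipschitz estimate along [u] holds for almost every time, outside a null set that must not
    depend on the functions compared. *)

Section Levels.
Variable R : realType.
Local Notation mu := (@lebesgue_measure R).

(* [simple_fun] for maps into an arbitrary type, so that several functions can
   be written over the level sets of a single map. *)
Definition simple_map (K : Type) (p : R -> K) : Prop :=
  finite_set (range p) /\
  forall k, measurable (p @^-1` [set k] : set (measurableTypeR R)).

Lemma simple_map_comp (K : choiceType) (K' : Type) (p : R -> K) (g : K -> K') :
  simple_map p -> simple_map (g \o p).
Proof.
move=> [fp mp]; split.
  by rewrite -(image_comp p g setT); exact: finite_image.
move=> k.
rewrite [X in measurable X](_ : _ =
    \bigcup_(i in range p `&` g @^-1` [set k]) p @^-1` [set i]).
  by apply: fin_bigcup_measurable => //; exact: finite_setIl.
apply/seteqP; split=> [r /= gk|r [i [_ gi] /= pi]].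
  by exists (p r) => //; split=> //; exists r.
by rewrite /= pi.
Qed.

Lemma simple_map_pair (K K' : choiceType) (p : R -> K) (q : R -> K') :
  simple_map p -> simple_map q -> simple_map (fun r => (p r, q r)).
Proof.
move=> [fp mp] [fq mq]; split.
  apply: (@sub_finite_set _ _ (range p `*` range q)); last exact: finite_setX.
  by move=> _ [r _ <-]; split; exists r.
move=> [k k'].
rewrite [X in measurable X](_ : _ = p @^-1` [set k] `&` q @^-1` [set k']).
  exact: measurableI.
apply/seteqP; split=> r /=; first by case.
by case=> -> ->.
Qed.

Lemma simple_map_comp2 (K1 K2 : choiceType) (K : Type) (g : K1 -> K2 -> K)
    (p : R -> K1) (q : R -> K2) :
  simple_map p -> simple_map q -> simple_map (fun r => g (p r) (q r)).
Proof.
move=> sp sq.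
exact: (simple_map_comp (fun k => g k.1 k.2) (simple_map_pair sp sq)).
Qed.

Lemma simple_map_mem (D : set R) :
  measurable (D : set (measurableTypeR R)) -> simple_map (fun r => r \in D).
Proof.
move=> mD; split; first exact: finite_finset.
case.
  rewrite [X in measurable X](_ : _ = D) //.
  by apply/seteqP; split=> r /=; [exact: set_mem|exact: mem_set].
rewrite [X in measurable X](_ : _ = ~` D); first exact: measurableC.
apply/seteqP; split=> r /=.
  by move=> rD /mem_set; rewrite rD.
by move=> nD; apply/negbTE/negP => /set_mem.
Qed.

Lemma measurable_shift (c : R) :
  measurable_fun [set: measurableTypeR R]
    ((fun r => r + c) : measurableTypeR R -> measurableTypeR R).
Proof. by apply: measurable_funD => //; exact: measurable_id. Qed.

Lemma measurable_preimage_shift (c : R) (E : set (measurableTypeR R)) :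
  measurable E ->
  measurable ((fun r => r + c) @^-1` E : set (measurableTypeR R)).
Proof.
by move=> mE; rewrite -[X in measurable X]setTI; exact: measurable_shift.
Qed.

(** Lebesgue measure is the only measure that gives half-open intervals their length, and its
    pushforward under a translation does so too. *)
Lemma lebesgue_measure_shift (c : R) (E : set (measurableTypeR R)) :
  measurable E -> mu ((fun r => r + c) @^-1` E) = mu E.
Proof.
move=> mE; rewrite -[LHS]/(pushforward mu
  ((fun r => r + c) : measurableTypeR R -> measurableTypeR R) E).
apply/esym/lebesgue_measure_unique => //=; first exact: measurable_shift.
move=> _ _ [[a b]] _ <-; rewrite /pushforward.
rewrite (_ : _ @^-1` _ = `](a - c), (b - c)]%classic).
  rewrite !lebesgue_measure_itv/= !lte_fin ltrD2r.
  by case: ifP => // _; rewrite -!EFinB; congr EFin; ring.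
by apply/seteqP; split=> r /=; rewrite !in_itv/= ltrBlDr lerBrDr.
Qed.

End Levels.

(** * Integrals of simple functions over sets of finite measure *)

Section Sint.
Variable R : realType.
Local Notation mu := (@lebesgue_measure R).

Definition level_weight (K : Type) (D : set R) (p : R -> K) (k : K) : R :=
  fine (mu (D `&` p @^-1` [set k])).

(** For an interval [D] this unfolds to [simple_integral]. A general [D] allows the domain to be cut
    and translated; a general [Y] includes the scalars [R^o]. *)
Definition sint (Y : normedModType R) (D : set R) (s : R -> Y) : Y :=
  \sum_(y \in range s) level_weight D s y *: y.

Definition finite_domain (D : set R) :=
  measurable (D : set (measurableTypeR R)) /\ (mu D < +oo)%E.

Lemma level_weight_ge0 (K : Type) (D : set R) (p : R -> K) (k : K) :
  0 <= level_weight D p k.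
Proof. exact: fine_ge0. Qed.

Section Domain.
Variable D : set R.
Hypothesis fD : finite_domain D.

Lemma level_weightE (K : Type) (p : R -> K) (k : K) : simple_map p ->
  mu (D `&` p @^-1` [set k]) = (level_weight D p k)%:E.
Proof.
case: fD => mD Doo [_ mp]; rewrite /level_weight fineK// ge0_fin_numE//.
apply: le_lt_trans Doo; apply: le_measure; rewrite ?inE//.
exact: measurableI.
Qed.

Lemma level_weight_comp (K K' : choiceType) (p : R -> K) (g : K -> K')
    (y : K') :
  simple_map p ->
  level_weight D (g \o p) y =
  \sum_(k \in range p) (if g k == y then level_weight D p k else 0).
Proof.
move=> sp; have [fp mp] := sp; have [mD _] := fD.
apply: EFin_inj; rewrite -level_weightE; last exact: simple_map_comp.
rewrite [X in mu X](_ : _ = \big[setU/set0]_(k \in range p `&` g @^-1` [set y])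
   (D `&` p @^-1` [set k])); last first.
  rewrite fsbig_setU; last exact: finite_setIl.
  apply/seteqP; split=> [r [Dr /= gy]|r [k [_ gk] [Dr /= pk]]].
    by exists (p r) => //; split=> //; exists r.
  by split=> //=; rewrite pk.
rewrite measure_fsbig; first last.
- by move=> k k' _ _ [r [[_ /= <-] [_ /= <-]]].
- by move=> k _; exact: measurableI.
- exact: finite_setIl.
rewrite fsbig_mkcondr fsbig_finite//= fsbig_finite//= -sumEFin.
apply: eq_bigr => k _; rewrite level_weightE//.
have -> : (k \in g @^-1` [set y]) = (g k == y).
  by apply/idP/eqP => [/set_mem|gk]; [|exact: mem_set].
by case: ifP.
Qed.

(** Each level set of [g \o p] is a finite union of level sets of [p], so the sum may run over the
    finer partition. With [p] a pair of simple functions this is a common partition for both, the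
    source of linearity. *)
Lemma sint_comp (Y : normedModType R) (K : choiceType) (p : R -> K)
    (g : K -> Y) :
  simple_map p ->
  sint D (g \o p) = \sum_(k \in range p) level_weight D p k *: g k.
Proof.
move=> sp; have [fp mp] := sp.
have [fs _] := simple_map_comp g sp.
rewrite /sint.
transitivity (\sum_(y \in range (g \o p)) \sum_(k \in range p)
    (if g k == y then level_weight D p k *: y else 0)).
  apply: eq_fsbigr => y _; rewrite level_weight_comp//.
  rewrite [in LHS]fsbig_finite// [in RHS]fsbig_finite//= scaler_suml.
  by apply: eq_bigr => k _; case: ifP => // _; rewrite scale0r.
rewrite exchange_fsbig//; apply: eq_fsbigr => k /set_mem [r _ pr].
rewrite (fsbigD1 (g k))//=; last by exists r => //=; rewrite pr.
rewrite eqxx fsbig1 ?addr0// => y [_ /= yk].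
by case: eqP => // gk; case: yk.
Qed.

Lemma sint_lin (Y : normedModType R) (c : R) (s t : R -> Y) :
  simple_map s -> simple_map t ->
  sint D (fun r => c *: s r + t r) = c *: sint D s + sint D t.
Proof.
move=> ss st; have sp := simple_map_pair ss st; have [fp _] := sp.
rewrite [LHS](@sint_comp Y _ _ (fun k : Y * Y => c *: k.1 + k.2) sp).
rewrite [X in _ *: X + _](@sint_comp Y _ _ (fun k : Y * Y => k.1) sp).
rewrite [X in _ + X](@sint_comp Y _ _ (fun k : Y * Y => k.2) sp).
rewrite !fsbig_finite//= scaler_sumr -big_split/=.
by apply: eq_bigr => k _; rewrite scalerDr !scalerA mulrC.
Qed.

Lemma sintB (Y : normedModType R) (s t : R -> Y) :
  simple_map s -> simple_map t ->
  sint D (fun r => s r - t r) = sint D s - sint D t.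
Proof.
move=> ss st; rewrite -[in RHS]scaleN1r addrC -sint_lin//.
by congr sint; apply/funext => r; rewrite scaleN1r addrC.
Qed.

Lemma sint_map (Y Z : normedModType R) (L : {linear Y -> Z}) (s : R -> Y) :
  simple_map s -> sint D (fun r => L (s r)) = L (sint D s).
Proof.
move=> ss; have [fs _] := ss.
rewrite [LHS](@sint_comp Z _ _ L ss) /sint !fsbig_finite//= linear_sum.
by apply: eq_bigr => k _; rewrite linearZ.
Qed.

(** The L1 seminorm as a finite sum; through [R^o] it is an instance of [sint] and inherits its
    rules. *)
Definition nsint (Y : normedModType R) (E : set R) (s : R -> Y) : R :=
  sint E (fun r => `|s r| : R^o).

Lemma nsint_ge0 (Y : normedModType R) (E : set R) (s : R -> Y) : 0 <= nsint E s.
Proof.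
apply: fsumr_ge0 => _ [r _ <-]; apply: mulr_ge0 => //.
exact: level_weight_ge0.
Qed.

Lemma nsintE (Y : normedModType R) (K : choiceType) (p : R -> K) (g : K -> Y) :
  simple_map p ->
  nsint D (g \o p) = \sum_(k \in range p) level_weight D p k * `|g k|.
Proof. exact: (@sint_comp R^o _ _ (fun k => `|g k| : R^o)). Qed.

Lemma ler_norm_sint (Y : normedModType R) (s : R -> Y) :
  simple_map s -> `|sint D s| <= nsint D s.
Proof.
move=> ss; have [fs _] := ss.
rewrite [X in _ <= X](@nsintE Y Y s id)// /sint !fsbig_finite//=.
apply: le_trans (ler_norm_sum _ _ _) _; apply: ler_sum => y _.
by rewrite normrZ ger0_norm// level_weight_ge0.
Qed.

Lemma nsint_lin (Y : normedModType R) (c : R) (s t : R -> Y) :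
  simple_map s -> simple_map t ->
  nsint D (fun r => c *: s r + t r) <= `|c| * nsint D s + nsint D t.
Proof.
move=> ss st; have sp := simple_map_pair ss st; have [fp _] := sp.
rewrite [X in X <= _](@nsintE Y _ _ (fun k : Y * Y => c *: k.1 + k.2) sp).
rewrite [X in _ * X + _](@nsintE Y _ _ (fun k : Y * Y => k.1) sp).
rewrite [X in _ + X](@nsintE Y _ _ (fun k : Y * Y => k.2) sp).
rewrite !fsbig_finite//= mulr_sumr -big_split/=.
apply: ler_sum => k _; rewrite mulrCA -mulrDr.
apply: ler_wpM2l; first exact: level_weight_ge0.
by rewrite -normrZ; exact: ler_normD.
Qed.

Lemma nsint_map (Y Z : normedModType R) (L : {linear Y -> Z}) (M : R)
    (s : R -> Y) : (forall y, `|L y| <= M * `|y|) ->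
  simple_map s -> nsint D (fun r => L (s r)) <= M * nsint D s.
Proof.
move=> LM ss; have [fs _] := ss.
rewrite [X in X <= _](@nsintE Z _ s L)// [X in _ * X](@nsintE Y Y s id)//.
rewrite !fsbig_finite//= mulr_sumr.
apply: ler_sum => k _; rewrite mulrCA.
by apply: ler_wpM2l => //; exact: level_weight_ge0.
Qed.

End Domain.

(** A null overlap is allowed because adjacent closed intervals share an endpoint. *)
Lemma sint_union (Y : normedModType R) (D1 D2 : set R) (s : R -> Y) :
  finite_domain D1 -> finite_domain D2 -> mu (D1 `&` D2) = 0%E ->
  simple_map s -> sint (D1 `|` D2) s = sint D1 s + sint D2 s.
Proof.
move=> f1 f2 D12 ss; have [fs ms] := ss; have [m1 _] := f1; have [m2 _] := f2.
rewrite /sint !fsbig_finite//= -big_split/=; apply: eq_bigr => y _.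
rewrite -scalerDl; congr (_ *: _); apply: EFin_inj.
have fD : finite_domain (D1 `|` D2).
  split; first exact: measurableU.
  apply: le_lt_trans (measureU2 _ _ _) _ => //.
  by rewrite lte_add_pinfty//; [case: f1|case: f2].
rewrite EFinD -!level_weightE//.
rewrite setIUl measureUfinl//.
- rewrite [X in (_ - X)%E](_ : _ = 0%E) ?sube0//.
  apply/eqP; rewrite eq_le measure_ge0 andbT -D12.
  apply: le_measure; rewrite ?inE; [|exact: measurableI|].
    by apply: measurableI; exact: measurableI.
  by move=> r [[? _] [? _]].
- exact: measurableI.
- exact: measurableI.
- by apply: le_lt_trans (ltry (level_weight D1 s y)); rewrite -level_weightE.
Qed.

Lemma range_shift (K : Type) (c : R) (p : R -> K) :
  range (fun r => p (r + c)) = range p.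
Proof.
apply/seteqP; split=> _ [r _ <-]; first by exists (r + c).
by exists (r - c) => //; rewrite subrK.
Qed.

Lemma simple_map_shift (K : Type) (c : R) (p : R -> K) :
  simple_map p -> simple_map (fun r => p (r + c)).
Proof.
move=> [fp mp]; split; first by rewrite range_shift.
by move=> k; exact: (measurable_preimage_shift c (mp k)).
Qed.

Lemma sint_shift (Y : normedModType R) (c : R) (D : set R) (s : R -> Y) :
  measurable (D : set (measurableTypeR R)) -> simple_map s ->
  sint ((fun r => r + c) @^-1` D) (fun r => s (r + c)) = sint D s.
Proof.
move=> mD [_ ms]; rewrite /sint range_shift; apply: eq_fsbigr => y _.
congr (_ *: _); congr fine.
rewrite -[RHS](lebesgue_measure_shift c) //; exact: measurableI.
Qed.

Lemma nsint_shift (Y : normedModType R) (c : R) (D : set R) (s : R -> Y) :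
  measurable (D : set (measurableTypeR R)) -> simple_map s ->
  nsint ((fun r => r + c) @^-1` D) (fun r => s (r + c)) = nsint D s.
Proof.
move=> mD ss; rewrite /nsint.
exact: (sint_shift c mD (simple_map_comp (fun y => `|y| : R^o) ss)).
Qed.

Lemma nsint_union (Y : normedModType R) (D1 D2 : set R) (s : R -> Y) :
  finite_domain D1 -> finite_domain D2 -> mu (D1 `&` D2) = 0%E ->
  simple_map s -> nsint (D1 `|` D2) s = nsint D1 s + nsint D2 s.
Proof.
move=> f1 f2 D12 ss.
exact: (sint_union f1 f2 D12 (simple_map_comp (fun y => `|y| : R^o) ss)).
Qed.

(** The bridge from finite sums to the Lebesgue integral: the norm of [s] is a finite combination of
    indicators of level sets. *)
Lemma integral_normE (Y : normedModType R) (D : set R) (s : R -> Y) :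
  finite_domain D -> simple_map s ->
  (\int[mu]_(r in D) (`|s r|%:E))%E = (nsint D s)%:E.
Proof.
move=> fD ss; have [fs ms] := ss; have [mD _] := fD.
transitivity (\int[mu]_(r in D) (\sum_(y \in range s)
   (`|y|%:E * (\1_(s @^-1` [set y]) r)%:E)))%E.
  apply: eq_integral => r _; rewrite (fsbigD1 (s r))//=; last by exists r.
  rewrite indicE mem_set// mule1 fsbig1 ?adde0// => y [_ /= yr].
  rewrite indicE memNset ?mule0//= => /esym; exact: yr.
have mi y : measurable_fun D
    ((\1_(s @^-1` [set y]) : measurableTypeR R -> R)).
  by apply: (@measurable_indic _ (measurableTypeR R)); exact: ms.
transitivity ((\sum_(y \in range s)
   (\int[mu]_(r in D) (`|y|%:E * (\1_(s @^-1` [set y]) r)%:E)))%E).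
  apply: (@ge0_integral_fsum _ (measurableTypeR R) R mu D mD Y
    (fun y r => (`|y|%:E * (\1_(s @^-1` [set y]) r)%:E)%E)) => //.
  by move=> y; apply: measurable_funeM; exact/measurable_EFinP.
have -> : nsint D s = _ := @nsintE _ fD Y Y s id ss; rewrite !fsbig_finite//= -sumEFin.
apply: eq_bigr => y _.
rewrite (@ge0_integralZl _ (measurableTypeR R))//.
- rewrite EFinM [RHS]muleC; congr (_ * _)%E.
  by rewrite integral_indic// setIC; exact: level_weightE.
- exact/measurable_EFinP.
Qed.

End Sint.

(** * Bochner integral *)

Section LowerIntegral.
Local Open Scope ereal_scope.
Context d (T : measurableType d) (R : realType) (mu : {measure set T -> \bar R}).

(* The integral of a nonnegative function is a supremum over the simple
   functions below it, hence monotone even without measurability. *)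
Lemma ge0_le_integral_nomeas (D E : set T) (f g : T -> \bar R) :
  (forall x, D x -> 0 <= f x) -> (forall x, E x -> 0 <= g x) ->
  D `<=` E -> (forall x, D x -> f x <= g x) ->
  \int[mu]_(x in D) f x <= \int[mu]_(x in E) g x.
Proof.
move=> f0 g0 DE fg; rewrite !ge0_integralE//.
apply: ge_ereal_sup => _ [h /= hf <-].
apply: ereal_sup_ubound => /=; exists h => //= x; apply: le_trans (hf x) _.
rewrite /patch; case: ifPn => xD.
  have Dx := set_mem xD.
  by rewrite mem_set; [exact: fg|exact: DE].
by case: ifPn => // /set_mem; exact: g0.
Qed.

(** On [N] nothing is known about [f] beyond its sign. The majorant [h], equal to [f] off [N] and
    infinite on [N], is measurable and its integral does not see [N]; monotonicity of the lower
    integral concludes. *)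
Lemma ge0_integral_setD_null (D N : set T) (f : T -> \bar R) :
  measurable D -> measurable N -> mu N = 0 ->
  measurable_fun (D `\` N) f -> (forall x, D x -> 0 <= f x) ->
  \int[mu]_(x in D) f x <= \int[mu]_(x in D `\` N) f x.
Proof.
move=> mD mN N0 mf f0.
pose h x := (f \_ (D `\` N)) x + +oo * (\1_N x)%:E.
have mh1 : measurable_fun D (f \_ (D `\` N)).
  apply/(measurable_restrict _ _ _).1 => //; first exact: measurableD.
  by rewrite setIC setIidl//; exact: subDsetl.
have h10 x : D x -> 0 <= (f \_ (D `\` N)) x.
  by move=> Dx; apply: erestrict_ge0 => // y [Dy _]; exact: f0.
have mh2 : measurable_fun D (fun x => (\1_N x : R)%:E).
  by apply/measurable_EFinP; exact: measurable_indic.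
have -> : \int[mu]_(x in D `\` N) f x = \int[mu]_(x in D) h x.
  rewrite ge0_integralD//.
  - rewrite ge0_integralZl//.
    rewrite integral_indic// (_ : mu _ = 0) ?mule0 ?adde0.
      by rewrite -integral_mkcondr setIidr//; exact: subDsetl.
    by apply/eqP; rewrite -measure_le0 -N0; apply: le_measure;
      rewrite ?inE//; exact: measurableI.
  - exact: measurable_funeM.
apply: ge0_le_integral_nomeas => // x Dx.
  by rewrite adde_ge0 ?h10// mule_ge0.
rewrite /h /patch indicE; have [Nx|Nx] := pselect (N x).
  rewrite (mem_set Nx) memNset; last by case.
  by rewrite mule1 add0e leey.
by rewrite (memNset Nx) mem_set// mule0 adde0.
Qed.

Lemma limn_einf_le (u : (\bar R)^nat) (e : \bar R) :
  (forall n, u n <= e) -> limn_einf u <= e.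
Proof.
move=> ue; rewrite limn_einf_lim; apply: lime_le; first exact: is_cvg_einfs.
apply: nearW => n; apply: le_trans (ue n).
by apply: ereal_inf_lbound; exists n => /=.
Qed.

End LowerIntegral.

(** * The Bochner integral through Cauchy sequences of simple functions *)

Section BochnerCauchy.
Variable R : realType.
Local Notation mu := (@lebesgue_measure R).
Implicit Types (D : set R).

Lemma simple_map_measurable (D : set (measurableTypeR R)) (p : R -> R) :
  simple_map p -> measurable_fun D (p : measurableTypeR R -> R).
Proof.
move=> [fp mp]; apply: measurable_funTS => _ B mB; rewrite setTI.
rewrite [X in measurable X](_ : _ =
    \bigcup_(k in range p `&` B) p @^-1` [set k]).
  by apply: fin_bigcup_measurable => //; exact: finite_setIl.
apply/seteqP; split=> [r /= Br|r [i [_ gi] /= pi]].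
  by exists (p r) => //; split=> //; exists r.
by rewrite /= pi.
Qed.

Lemma finite_domain_itv (a b : R) : finite_domain `[a, b].
Proof.
split; first exact: measurable_itv.
by rewrite lebesgue_measure_itv/=; case: ifP => // _; rewrite -EFinB ltry.
Qed.

Lemma ae_imp (P Q : R -> Prop) : (forall r, P r -> Q r) ->
  {ae mu, forall r : R, P r} -> {ae mu, forall r : R, Q r}.
Proof. by move=> PQ; apply: negligibleS => r /= nQ /PQ. Qed.

Lemma ae_imp2 (P Q S : R -> Prop) : (forall r, P r -> Q r -> S r) ->
  {ae mu, forall r : R, P r} -> {ae mu, forall r : R, Q r} ->
  {ae mu, forall r : R, S r}.
Proof.
move=> PQS aP aQ; apply: (@negligibleS _ _ _ mu _ _ _ (negligibleU aP aQ)).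
move=> r /= nS; apply: contrapT => /not_orP[/contrapT p /contrapT q].
by apply: nS; exact: PQS.
Qed.

Lemma ae_all (P : R -> Prop) : (forall r, P r) -> {ae mu, forall r : R, P r}.
Proof.
move=> p; apply: (@negligibleS _ _ _ mu set0); last exact: negligible_set0.
by move=> r /=; apply.
Qed.

Lemma ae_shift (c : R) (P : R -> Prop) :
  {ae mu, forall r : R, P r} -> {ae mu, forall r : R, P (r + c)}.
Proof.
move=> [N [mN N0 sub]]; exists ((fun r => r + c) @^-1` N); split.
- exact: measurable_preimage_shift.
- by rewrite -N0; exact: lebesgue_measure_shift.
- by move=> r; exact: sub.
Qed.

Variable Y : completeNormedModType R.
Implicit Types (s t : R -> Y) (f g : R -> Y).

Lemma simple_mapB s t : simple_map s -> simple_map t ->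
  simple_map (fun r => s r - t r).
Proof. exact: (@simple_map_comp2 R Y Y Y (fun x y => x - y)). Qed.

Lemma simple_map_norm s : simple_map s -> simple_map (fun r => `|s r|).
Proof. exact: (@simple_map_comp R Y R s (fun y => `|y|)). Qed.

Lemma cvg_dist (s : nat -> Y) (y z : Y) : s n @[n --> \oo] --> y ->
  (`|s n - z|%:E)%E @[n --> \oo] --> (`|y - z|%:E)%E.
Proof.
move=> sy; apply/fine_cvgP; split; first exact: nearW.
by apply: cvg_norm; apply: cvgB => //; exact: cvg_cst.
Qed.

Lemma measurable_dist (D : set (measurableTypeR R)) (s : nat -> R -> Y) t f :
  (forall n, simple_map (s n)) -> simple_map t ->
  (forall r, D r -> s n r @[n --> \oo] --> f r) ->
  measurable_fun D (fun r : measurableTypeR R => `|f r - t r|%:E).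
Proof.
move=> ss st sf.
apply: (emeasurable_fun_cvg (fun n r => `|s n r - t r|%:E)) => [m|r Dr].
  apply/measurable_EFinP; apply: simple_map_measurable.
  by apply: simple_map_norm; exact: simple_mapB.
by apply: cvg_dist; exact: sf.
Qed.

(** Fatou's lemma carries the Cauchy bound to the limit. It is applied off the null set where
    convergence may fail, because the norm of [f - t] is measurable on what remains. *)
Lemma fatou_simple D (s : nat -> R -> Y) t f (e : R) (N : nat) :
  finite_domain D -> (forall n, simple_map (s n)) -> simple_map t ->
  {ae mu, forall r : R, D r -> s n r @[n --> \oo] --> f r} ->
  (forall n, (N <= n)%N -> nsint D (fun r => s n r - t r) <= e) ->
  (\int[mu]_(r in D) (`|f r - t r|%:E) <= e%:E)%E.
Proof.
move=> fD ss st [N0 [mN0 N00 sub]] le; have [mD _] := fD.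
have sf r : (D `\` N0) r -> s n r @[n --> \oo] --> f r.
  by move=> [Dr Nr]; apply: contrapT => ns; apply: Nr; apply: sub => /= /(_ Dr).
have mg (u : R -> Y) : simple_map u -> measurable_fun (D : set (measurableTypeR R))
    (fun r : measurableTypeR R => `|u r|%:E).
  move=> su; apply/measurable_EFinP; apply: simple_map_measurable.
  exact: simple_map_norm.
apply: le_trans (@ge0_integral_setD_null _ (measurableTypeR R) R mu D N0
  (fun r => `|f r - t r|%:E) mD mN0 N00 _ _) _ => //.
  exact: (measurable_dist (D := D `\` N0) ss st sf).
(* Dropping the first [N] terms makes the bound hold at every index and leaves the lower limit
   unchanged. *)
pose g n (r : measurableTypeR R) := `|s (n + N)%N r - t r|%:E.
have -> : (\int[mu]_(r in D `\` N0) (`|f r - t r|%:E) =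
    \int[mu]_(r in D `\` N0) limn_einf (g^~ r))%E.
  apply: eq_integral => r /set_mem Dr; apply/esym.
  apply: (cvg_limn_einf_sup _).1.
  rewrite (cvg_shiftn N (fun n => `|s n r - t r|%:E)).
  by apply: cvg_dist; exact: sf.
apply: le_trans (@fatou _ (measurableTypeR R) R mu (D `\` N0) _ g _ _) _.
- exact: measurableD.
- by move=> n; apply: measurable_funS (mg _ (simple_mapB (ss (n + N)%N) st)).
- by move=> n r _; rewrite lee_fin.
apply: limn_einf_le => n; apply: le_trans (_ : _ <= \int[mu]_(r in D) g n r)%E _.
  by apply: (@ge0_le_integral_nomeas _ (measurableTypeR R)) => // r;
    rewrite ?lee_fin// => -[].
rewrite integral_normE//; last exact: simple_mapB.
by rewrite lee_fin; apply: le; exact: leq_addl.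
Qed.

(* Unlike in [bochner_integral], only measurable functions are integrated here:
   the integral of |f - s n| there is a priori a lower integral. *)
Definition bint D f (v : Y) : Prop :=
  exists s : nat -> R -> Y,
    [/\ forall n, simple_map (s n),
        {ae mu, forall r : R, D r -> s n r @[n --> \oo] --> f r},
        forall e, 0 < e -> exists N, forall n m, (N <= n)%N -> (N <= m)%N ->
          nsint D (fun r => s n r - s m r) <= e &
        sint D (s n) @[n --> \oo] --> v].

(** Forwards, the triangle inequality through [f] is integrated off the null set, where both terms
    are measurable and the integral is additive. Backwards, [fatou_simple] turns the Cauchy bound
    into convergence of the integrals. *)
Lemma bochner_bint (a b : R) f v :
  bochner_integral a b f v <-> bint `[a, b] f v.
Proof.
have fD := finite_domain_itv a b; have [mD _] := fD.
split=> -[s [ss sf sc sv]]; exists s; split=> //.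
{ move=> e e0; have e20 : 0 < e / 2 by rewrite divr_gt0.
  move/fine_cvgP: sc => -[].
  move=> [N1 _ h1] /cvgr0_norm_lt /(_ _ e20) [N2 _ h2].
  exists (maxn N1 N2) => n m; rewrite !geq_max => /andP[n1 n2] /andP[m1 m2].
  have le k : (N1 <= k)%N -> (N2 <= k)%N ->
      (\int[mu]_(r in `[a, b]) (`|f r - s k r|%:E) <= (e / 2)%:E)%E.
    move=> k1 k2; rewrite -[leLHS]fineK; last exact: h1.
    by rewrite lee_fin; apply: le_trans (ler_norm _) _; apply/ltW/h2.
  have [N0 [mN0 N00 sub]] := sf.
  have sf' r : (`[a, b] `\` N0) r -> s n r @[n --> \oo] --> f r.
    move=> [Dr Nr]; apply: contrapT => ns; apply: Nr; apply: sub => /=.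
    by move=> /(_ Dr).
  have mD' : measurable (`[a, b] `\` N0 : set (measurableTypeR R)).
    exact: measurableD.
  rewrite -lee_fin -integral_normE//; last exact: (simple_mapB (ss n) (ss m)).
  rewrite (@ge0_negligible_integral _ (measurableTypeR R) R mu _ N0)//; last first.
    apply/measurable_EFinP; apply: simple_map_measurable.
    by apply: simple_map_norm; exact: (simple_mapB (ss n) (ss m)).
  apply: le_trans (_ : _ <= \int[mu]_(r in `[a, b] `\` N0)
      (`|f r - s n r|%:E + `|f r - s m r|%:E))%E _.
    apply: (@ge0_le_integral_nomeas _ (measurableTypeR R)) => // r _.
      by rewrite -EFinD lee_fin addr_ge0.
    by rewrite -EFinD lee_fin (distrC (f r) (s n r)) ler_distD.
  rewrite (@ge0_integralD _ (measurableTypeR R))//; first last.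
      exact: (measurable_dist ss (ss m) sf').
    exact: (measurable_dist ss (ss n) sf').
  rewrite [e]splitr EFinD; apply: leeD.
    apply: le_trans (le n n1 n2).
    by apply: (@ge0_le_integral_nomeas _ (measurableTypeR R)) => // r [].
  apply: le_trans (le m m1 m2).
  by apply: (@ge0_le_integral_nomeas _ (measurableTypeR R)) => // r []. }
have {}ss n : simple_map (s n) := ss n.
have le e : 0 < e -> \forall n \near \oo,
      (\int[mu]_(r in `[a, b]) (`|f r - s n r|%:E) <= e%:E)%E.
    move=> /sc[N hN]; exists N => // n /= Nn.
    by apply: (fatou_simple (N := N) fD ss (ss n) sf) => m Nm; exact: hN.
  have fin e (n : nat) : (\int[mu]_(r in `[a, b]) (`|f r - s n r|%:E) <= e%:E)%E ->
      (\int[mu]_(r in `[a, b]) (`|f r - s n r|%:E))%E \is a fin_num.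
    by move=> h; rewrite ge0_fin_numE ?integral_ge0//; exact: le_lt_trans (ltry e).
  apply/fine_cvgP; split.
    by apply: filterS (le 1 ltr01) => n; exact: fin.
  apply/cvgr0Pnorm_le => e e0; apply: filterS (le e e0) => n h.
  by rewrite ger0_norm ?fine_ge0 ?integral_ge0// -lee_fin fineK ?(fin e).
Qed.

End BochnerCauchy.

Section Sequences.
Variables (R : realType) (Y : completeNormedModType R).
Implicit Types (s : nat -> Y) (y z : Y).

Lemma cvg_seqP s y : s n @[n --> \oo] --> y <->
  forall e : R, 0 < e -> exists N, forall n, (N <= n)%N -> `|s n - y| <= e.
Proof.
split=> [/cvgrPdist_le sy e /sy[N _ hN]|h].
  by exists N => n Nn; rewrite distrC; exact: hN.
by apply/cvgrPdist_le => e /h[N hN]; exists N => // n /= Nn; rewrite distrC hN.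
Qed.

Lemma cvg_seq_unique s y z :
  s n @[n --> \oo] --> y -> s n @[n --> \oo] --> z -> y = z.
Proof. exact: cvg_unique. Qed.

Lemma cauchy_seq_cvg s :
  (forall e : R, 0 < e -> exists N, forall n m, (N <= n)%N -> (N <= m)%N ->
     `|s n - s m| <= e) -> exists y, s n @[n --> \oo] --> y.
Proof.
move=> sc; suff: cvgn s by move=> /cvg_ex[y sy]; exists y.
apply: cauchy_cvg; apply: cauchy_exP => e e0.
have [N hN] := sc (e / 2) (divr_gt0 e0 (ltr0Sn _ _)).
exists (s N); exists N => // n /= Nn; rewrite -ball_normE /=.
apply: le_lt_trans (hN _ _ (leqnn N) Nn) _.
by rewrite ltr_pdivrMr// ltr_pMr// ltr1n.
Qed.

Lemma cvg_seq_norm_le s y (M : R) :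
  s n @[n --> \oo] --> y -> (exists N, forall n, (N <= n)%N -> `|s n| <= M) ->
  `|y| <= M.
Proof.
move=> /cvg_seqP sy [N hN]; rewrite -[M]addr0; apply/ler_addgt0Pr => e e0.
have [N' hN'] := sy _ e0; pose n := maxn N N'.
rewrite -[y](subKr (s n)); apply: le_trans (ler_normB _ _) _.
by rewrite addr0 lerD ?hN ?hN' ?leq_maxl ?leq_maxr.
Qed.

End Sequences.

Lemma linear_continuous_bound (R : realType) (Y Z : normedModType R)
    (L : {linear Y -> Z}) : continuous L ->
  exists2 M : R, 0 <= M & forall y, `|L y| <= M * `|y|.
Proof.
move=> /linear_bounded_continuous/linear_boundedP [M [_ hM]].
exists (Num.max 0 (M + 1)); first by rewrite le_max lexx.
move=> y; apply: hM.
by rewrite lt_max ltrDl ltr01 orbT.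
Qed.

(** * Calculus of the Bochner integral *)

Section BintTheory.
Variable R : realType.
Local Notation mu := (@lebesgue_measure R).
Implicit Types (D : set R) (Y Z : completeNormedModType R).

Lemma bint_ae Y D (f g : R -> Y) v :
  {ae mu, forall r : R, D r -> f r = g r} -> bint D f v -> bint D g v.
Proof.
move=> fg [s [ss sf sc sv]]; exists s; split=> //.
by apply: ae_imp2 fg sf => r h1 h2 Dr; rewrite -h1//; exact: h2.
Qed.

Lemma bint_eq Y D (f g : R -> Y) v :
  (forall r, D r -> f r = g r) -> bint D f v -> bint D g v.
Proof. by move=> fg; apply: bint_ae; exact: ae_all. Qed.

Lemma simple_map_lin Y (c : R) (s t : R -> Y) : simple_map s -> simple_map t ->
  simple_map (fun r => c *: s r + t r).
Proof. exact: (@simple_map_comp2 R Y Y Y (fun x y => c *: x + y)). Qed.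

Lemma bint_lin Y D (c : R) (f g : R -> Y) v w : finite_domain D ->
  bint D f v -> bint D g w -> bint D (fun r => c *: f r + g r) (c *: v + w).
Proof.
move=> fD [s [ss sf sc sv]] [t [st tg tc tw]].
exists (fun n r => c *: s n r + t n r); split.
- by move=> n; exact: simple_map_lin.
- apply: ae_imp2 sf tg => r h1 h2 Dr.
  by apply: cvgD; [apply: cvgZr; exact: h1|exact: h2].
- move=> e e0; pose d := e / (`|c| + 1).
  have c0 : 0 < `|c| + 1 by rewrite ltr_pwDr.
  have d0 : 0 < d by rewrite divr_gt0.
  have [N1 h1] := sc _ d0; have [N2 h2] := tc _ d0.
  exists (maxn N1 N2) => n m; rewrite !geq_max => /andP[n1 n2] /andP[m1 m2].
  rewrite (_ : (fun r => _) = (fun r => c *: (s n r - s m r) + (t n r - t m r))).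
    apply: le_trans (nsint_lin fD c (simple_mapB (ss n) (ss m))
      (simple_mapB (st n) (st m))) _.
    rewrite -[leRHS](divfK (lt0r_neq0 c0)) -/d mulrDr mulr1 mulrC.
    by apply: lerD; [apply: ler_wpM2r => //; exact: h1|exact: h2].
  by apply/funext => r; rewrite scalerBr opprD addrACA.
- rewrite (_ : (fun n => _) = (fun n => c *: sint D (s n) + sint D (t n))).
    by apply: cvgD => //; exact: cvgZr.
  by apply/funext => n; rewrite sint_lin.
Qed.

Lemma bint_map Y Z D (L : {linear Y -> Z}) (f : R -> Y) v : finite_domain D ->
  continuous L -> bint D f v -> bint D (fun r => L (f r)) (L v).
Proof.
move=> fD cL [s [ss sf sc sv]]; have [M M0 LM] := linear_continuous_bound cL.
exists (fun n r => L (s n r)); split.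
- by move=> n; exact: (@simple_map_comp R Y Z (s n) L).
- by apply: ae_imp sf => r h Dr; apply: (cvg_comp _ _ (h Dr)); exact: cL.
- move=> e e0; have M1 : 0 < M + 1 by rewrite ltr_wpDl.
  have [N hN] := sc _ (divr_gt0 e0 M1).
  exists N => n m Nn Nm.
  rewrite (_ : (fun r => _) = (fun r => L (s n r - s m r))); last first.
    by apply/funext => r; rewrite linearB.
  apply: le_trans (nsint_map fD LM (simple_mapB (ss n) (ss m))) _.
  apply: le_trans (ler_wpM2l M0 (hN _ _ Nn Nm)) _.
  by rewrite mulrCA ler_piMr ?(ltW e0)// ler_pdivrMr// mul1r lerDl.
- rewrite (_ : (fun n => _) = (fun n => L (sint D (s n)))).
    by apply: (cvg_comp _ _ sv); exact: cL.
  by apply/funext => n; exact: sint_map.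
Qed.

Lemma bint0 Y D : bint D (fun=> 0 : Y) 0.
Proof.
have s0 E : sint E (fun=> 0 : Y) = 0.
  by apply: fsbig1 => _ [r _ <-]; rewrite scaler0.
have n0 E : nsint E (fun=> 0 : Y) = 0.
  by apply: fsbig1 => _ [r _ <-]; rewrite normr0 scaler0.
exists (fun n r => 0); split.
- move=> n; apply: (@simple_map_comp R bool Y (fun r => r \in [set: R]) (fun=> 0)).
  by apply: simple_map_mem; exact: measurableT.
- by apply: ae_all => r _; exact: cvg_cst.
- move=> e e0; exists 0 => n m _ _.
  by under eq_fun do rewrite subr0; rewrite n0 ltW.
- by under eq_fun do rewrite s0; exact: cvg_cst.
Qed.

(** By linearity [v - w] is an integral of the zero function. Fatou then bounds the seminorm of the
    approximants [t n] themselves, hence the norm of their integrals, by any [e]. *)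
Lemma bint_unique Y D (f : R -> Y) v w : finite_domain D ->
  bint D f v -> bint D f w -> v = w.
Proof.
move=> fD hv hw; apply/eqP; rewrite -subr_eq0.
have [t [st t0 tc tvw]] : bint D (fun=> 0 : Y) (v - w).
  rewrite addrC -scaleN1r; have := bint_lin (-1) fD hw hv.
  by apply: bint_eq => r _; rewrite scaleN1r addNr.
rewrite -normr_le0; apply/ler_addgt0Pr => e e0; rewrite add0r.
have [N hN] := tc _ e0; apply: (cvg_seq_norm_le tvw); exists N => n Nn.
apply: le_trans (ler_norm_sint fD (st n)) _; rewrite -lee_fin -integral_normE//.
have := @fatou_simple R Y D t (t n) (fun=> 0) e N fD st (st n) t0.
under eq_integral do rewrite sub0r normrN.
by apply => m Nm; exact: hN.
Qed.

Lemma bint_shift Y D (c : R) (f : R -> Y) v : finite_domain D ->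
  bint D f v -> bint ((fun r => r + c) @^-1` D) (fun r => f (r + c)) v.
Proof.
move=> [mD _] [s [ss sf sc sv]]; exists (fun n r => s n (r + c)); split.
- by move=> n; exact: (simple_map_shift c (ss n)).
- exact: (ae_shift c sf).
- move=> e /sc[N hN]; exists N => n m Nn Nm.
  by rewrite (nsint_shift c mD (simple_mapB (ss n) (ss m))) hN.
- rewrite (_ : (fun n => _) = (fun n => sint D (s n)))//.
  by apply/funext => n; exact: sint_shift.
Qed.

(** On the partition by pairs, a pair with distinct entries has its level set in [D] contained in
    [N], hence has weight zero. *)
Lemma sint_eq_ae (Y : normedModType R) D (s t : R -> Y) (N : set R) :
  finite_domain D ->
  simple_map s -> simple_map t ->
  measurable (N : set (measurableTypeR R)) -> mu N = 0%E ->
  (forall r, D r -> ~ N r -> s r = t r) -> sint D s = sint D t.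
Proof.
move=> fD ss st mN N0 st_eq; have sp := simple_map_pair ss st.
have [fp mp] := sp; have [mD _] := fD.
rewrite [LHS](@sint_comp R D fD Y _ _ (fun k : Y * Y => k.1) sp).
rewrite [RHS](@sint_comp R D fD Y _ _ (fun k : Y * Y => k.2) sp).
apply: eq_fsbigr => -[y z] _ /=.
have [->//|yz] := eqVneq y z.
suff -> : level_weight D (fun r => (s r, t r)) (y, z) = 0 by rewrite !scale0r.
apply: EFin_inj; rewrite -level_weightE//; apply/eqP.
rewrite -measure_le0 -N0; apply: le_measure; rewrite ?inE//.
  exact: measurableI.
move=> r [Dr /= [sy tz]]; apply: contrapT => Nr.
by move/eqP: yz; apply; rewrite -sy -tz st_eq.
Qed.

Lemma nsint_eq_ae Y D (s t : R -> Y) (N : set R) : finite_domain D ->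
  simple_map s -> simple_map t ->
  measurable (N : set (measurableTypeR R)) -> mu N = 0%E ->
  (forall r, D r -> ~ N r -> s r = t r) -> nsint D s = nsint D t.
Proof.
move=> fD ss st mN N0 st_eq.
apply: (@sint_eq_ae R^o _ _ _ N fD) => //; try exact: simple_map_norm.
by move=> r Dr Nr; rewrite st_eq.
Qed.

Lemma bint_union Y D1 D2 (f : R -> Y) v w :
  finite_domain D1 -> finite_domain D2 -> mu (D1 `&` D2) = 0%E ->
  bint D1 f v -> bint D2 f w -> bint (D1 `|` D2) f (v + w).
Proof.
move=> f1 f2 D12 [s [ss sf sc sv]] [t [st tf tc tw]].
have [m1 _] := f1; have [m2 _] := f2.
pose g (b : bool) (x y : Y) := if b then x else y.
(* The approximant follows [s] on [D1] and [t] elsewhere; on [D2] it can differ from [t] only in the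
   null overlap. *)
pose u n r := g (r \in D1) (s n r) (t n r).
have su n : simple_map (u n).
  exact: (@simple_map_comp2 R bool (Y * Y)%type Y (fun b k => g b k.1 k.2) _ _
    (simple_map_mem m1) (simple_map_pair (ss n) (st n))).
have u1 r n : D1 r -> u n r = s n r by move=> Dr; rewrite /u mem_set.
have u2 r n : D2 r -> ~ (D1 `&` D2) r -> u n r = t n r.
  by move=> Dr nD; rewrite /u memNset// => D1r; apply: nD.
have m12 : measurable (D1 `&` D2 : set (measurableTypeR R)).
  exact: measurableI.
exists u; split=> //.
- have a12 : {ae mu, forall r : R, ~ (D1 `&` D2) r}.
    by exists (D1 `&` D2); split=> // r /= /contrapT.
  apply: ae_imp2 a12 (ae_imp2 (S := fun r => (D1 r -> s n r @[n --> \oo] --> f r)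
     /\ (D2 r -> t n r @[n --> \oo] --> f r)) _ sf tf) => // r nD [h1 h2] [Dr|Dr].
    by under eq_fun do rewrite u1//; exact: h1.
  by under eq_fun do rewrite u2//; exact: h2.
- move=> e e0; have e2 : 0 < e / 2 by rewrite divr_gt0.
  have [N1 h1] := sc _ e2; have [N2 h2] := tc _ e2.
  exists (maxn N1 N2) => n m; rewrite !geq_max => /andP[n1 n2] /andP[m1' m2'].
  rewrite nsint_union//; last exact: simple_mapB.
  rewrite [e]splitr; apply: lerD.
    rewrite (@nsint_eq_ae _ _ _ (fun r => s n r - s m r) set0)//; first exact: h1.
    - exact: simple_mapB.
    - exact: simple_mapB.
    - by move=> r Dr _; rewrite !u1.
  rewrite (@nsint_eq_ae _ _ _ (fun r => t n r - t m r) (D1 `&` D2))//.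
  - exact: h2.
  - exact: simple_mapB.
  - exact: simple_mapB.
  - by move=> r Dr nD; rewrite !u2.
- rewrite (_ : (fun n => _) = (fun n => sint D1 (s n) + sint D2 (t n))).
    exact: cvgD.
  apply/funext => n; rewrite sint_union//; congr (_ + _).
    by apply: (@sint_eq_ae _ _ _ _ set0) => // r Dr _; rewrite u1.
  by apply: (@sint_eq_ae _ _ _ _ (D1 `&` D2)) => // r Dr nD; rewrite u2.
Qed.

(** The seminorm over a piece is at most the one over the union, so the same approximants are Cauchy
    on each piece and completeness of [Y] supplies both integrals. *)
Lemma bint_restrict Y D1 D2 (f : R -> Y) v :
  finite_domain D1 -> finite_domain D2 -> mu (D1 `&` D2) = 0%E ->
  bint (D1 `|` D2) f v ->
  exists v1 v2, [/\ bint D1 f v1, bint D2 f v2 & v = v1 + v2].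
Proof.
move=> f1 f2 D12 [s [ss sf sc sv]].
have le1 n m : nsint D1 (fun r => s n r - s m r) <=
    nsint (D1 `|` D2) (fun r => s n r - s m r).
  by rewrite nsint_union ?lerDl ?nsint_ge0//; exact: simple_mapB.
have le2 n m : nsint D2 (fun r => s n r - s m r) <=
    nsint (D1 `|` D2) (fun r => s n r - s m r).
  by rewrite nsint_union ?lerDr ?nsint_ge0//; exact: simple_mapB.
have lim D : finite_domain D -> (forall n m, nsint D (fun r => s n r - s m r) <=
    nsint (D1 `|` D2) (fun r => s n r - s m r)) ->
    exists y : Y, sint D (s n) @[n --> \oo] --> y.
  move=> fD le; apply: cauchy_seq_cvg => e /sc[N hN];
    exists N => n m Nn Nm.
  rewrite -sintB//; apply: le_trans (ler_norm_sint fD (simple_mapB (ss n) (ss m))) _.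
  exact: le_trans (le n m) (hN _ _ Nn Nm).
have [v1 sv1] := lim _ f1 le1; have [v2 sv2] := lim _ f2 le2.
exists v1, v2; split.
- exists s; split=> //.
    by apply: ae_imp sf => r h Dr; apply: h; left.
  by move=> e /sc[N hN]; exists N => n m Nn Nm; exact: le_trans (le1 n m) (hN _ _ Nn Nm).
- exists s; split=> //.
    by apply: ae_imp sf => r h Dr; apply: h; right.
  by move=> e /sc[N hN]; exists N => n m Nn Nm; exact: le_trans (le2 n m) (hN _ _ Nn Nm).
- apply: (cvg_seq_unique sv).
  under eq_fun do rewrite sint_union//.
  exact: cvgD.
Qed.

End BintTheory.

(** * Essentially bounded inputs and the convolution integral *)

Section LinfTheory.
Variable R : realType.
Local Notation mu := (@lebesgue_measure R).
Implicit Types (D : set R) (Y : completeNormedModType R).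

(** The essential supremum runs over the whole line, with value 0 off [D]; hence the sign condition
    on [M]. *)
Lemma Linf_norm_leP Y D (u : R -> Y) (M : R) : 0 <= M ->
  (Linf_norm D u <= M%:E)%E <->
  {ae mu, forall r : R, D r -> `|u r| <= M}.
Proof.
move=> M0; split.
  move/ess_supP; apply: ae_imp => r; rewrite /= /patch lee_fin.
  by move=> h Dr; move: h; rewrite mem_set.
move=> h; apply/ess_supP; apply: ae_imp h => r h /=.
rewrite lee_fin /patch; case: ifPn => [/set_mem|_ //]; exact: h.
Qed.

Lemma Linf_norm_bound Y D (u : R -> Y) : (Linf_norm D u < +oo)%E <->
  exists2 M, 0 <= M & {ae mu, forall r : R, D r -> `|u r| <= M}.
Proof.
split=> [uoo|[M M0 /Linf_norm_leP uM]]; last first.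
  exact: le_lt_trans (uM M0) (ltry _).
have [M M0 uM] : exists2 M, 0 <= M & (Linf_norm D u <= M%:E)%E.
  move: uoo; case: (Linf_norm D u) => [x _| |_] //.
    by exists (Num.max 0 x); rewrite ?lee_fin le_max lexx ?orbT.
  by exists 0 => //; exact: leNye.
by exists M => //; exact/Linf_norm_leP.
Qed.

(** Right translation padded with zero; for negative [c] it is the left translation at nonnegative
    times. *)
Definition delay Y (c : R) (u : R -> Y) (s : R) : Y :=
  if 0 <= s - c then u (s - c) else 0.

Lemma delayE Y (c : R) (u : R -> Y) s : c <= s -> delay c u s = u (s - c).
Proof. by move=> cs; rewrite /delay subr_ge0 cs. Qed.

Lemma delay_lt Y (c : R) (u : R -> Y) s : s < c -> delay c u s = 0.
Proof. by move=> cs; rewrite /delay subr_ge0 leNgt cs. Qed.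

Lemma strongly_measurable_eq Y (u v : R -> Y) :
  (forall r, 0 <= r -> u r = v r) -> strongly_measurable u ->
  strongly_measurable v.
Proof.
move=> uv [s ss su]; exists s => //; apply: ae_imp su => r h r0.
by rewrite -uv//; exact: h.
Qed.

Lemma strongly_measurable_sub Y (u v : R -> Y) :
  strongly_measurable u -> strongly_measurable v ->
  strongly_measurable (fun r => u r - v r).
Proof.
move=> [s ss su] [t st tv]; exists (fun n r => s n r - t n r).
  by move=> n; exact: (simple_mapB (ss n) (st n)).
by apply: ae_imp2 su tv => r h1 h2 r0; apply: cvgB; [exact: h1|exact: h2].
Qed.

Lemma strongly_measurable_delay Y (c : R) (u : R -> Y) :
  strongly_measurable u -> strongly_measurable (delay c u).
Proof.
move=> [s ss su]; pose g (b : bool) (y : Y) := if b then y else 0.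
(* The approximants are not controlled at negative times, so they are cut to zero there before being
   shifted. *)
pose s' n r := g (r \in `[0, +oo[%classic) (s n r).
have ss' n : simple_map (s' n).
  apply: (@simple_map_comp2 R bool Y Y g _ _ _ (ss n)).
  by apply: simple_map_mem; exact: measurable_itv.
exists (fun n r => s' n (r - c)).
  by move=> n; exact: (simple_map_shift (- c) (ss' n)).
have := ae_shift (- c) su; apply: ae_imp => r h _.
rewrite /delay /s' /g.
have -> : (r - c \in `[0, +oo[%classic) = (0 <= r - c).
  by rewrite mem_setE in_itv/= andbT.
by case: ifPn => [|_]; [exact: h|exact: cvg_cst].
Qed.

Lemma Linf_loc_eq Y (u v : R -> Y) :
  (forall r, 0 <= r -> u r = v r) -> Linf_loc u -> Linf_loc v.
Proof.
move=> uv [su lu]; split; first exact: strongly_measurable_eq su.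
move=> t /lu /Linf_norm_bound[M M0 uM]; apply/Linf_norm_bound; exists M => //.
apply: ae_imp uM => r h /=; rewrite in_itv/= => /andP[r0 rt].
by rewrite -uv//; apply: h; rewrite /= in_itv/= r0.
Qed.

Lemma Linf_loc_sub Y (u v : R -> Y) :
  Linf_loc u -> Linf_loc v -> Linf_loc (fun r => u r - v r).
Proof.
move=> [su lu] [sv lv]; split; first exact: strongly_measurable_sub.
move=> t t0; apply/Linf_norm_bound.
have /Linf_norm_bound[M M0 uM] := lu _ t0.
have /Linf_norm_bound[N N0 vN] := lv _ t0.
exists (M + N); first exact: addr_ge0.
apply: ae_imp2 uM vN => r h1 h2 Dr; apply: le_trans (ler_normB _ _) _.
by apply: lerD; [exact: h1|exact: h2].
Qed.

Lemma Linf_loc_delay Y (c : R) (u : R -> Y) : Linf_loc u -> Linf_loc (delay c u).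
Proof.
move=> [su lu]; split; first exact: strongly_measurable_delay.
move=> t t0; apply/Linf_norm_bound.
have m0 : 0 <= Num.max 0 (t - c) by rewrite le_max lexx.
have /Linf_norm_bound[M M0 uM] := lu _ m0.
exists M => //; apply: ae_imp (ae_shift (- c) uM) => r h /=.
rewrite in_itv/= => /andP[r0 rt]; rewrite /delay; case: ifPn => rc.
  by apply: h; rewrite /= in_itv/= rc le_max lerB ?orbT.
by rewrite normr0.
Qed.

Lemma Linf_loc_shift Y (t : R) (u : R -> Y) : 0 <= t -> Linf_loc u ->
  Linf_loc (fun s => u (t + s)).
Proof.
move=> t0 /(Linf_loc_delay (- t)); apply: Linf_loc_eq => r r0.
by rewrite delayE ?opprK ?(addrC r)// lerNl (le_trans _ t0)// oppr_le0.
Qed.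

Lemma Linf_Linf_loc Y (u : R -> Y) : Linf u -> Linf_loc u.
Proof.
move=> [su /Linf_norm_bound[M M0 uM]]; split=> // t t0.
apply/Linf_norm_bound; exists M => //; apply: ae_imp uM => r h /=.
by rewrite in_itv/= => /andP[r0 _]; apply: h; rewrite /= in_itv/= r0.
Qed.

End LinfTheory.

Section Convolution.
Variables (R : realType) (U W : completeNormedModType R).
Local Notation mu := (@lebesgue_measure R).
Variables (S : R -> {linear W -> W}) (B : {linear U -> W}).
Hypothesis S0 : C0_semigroup S.
Implicit Types (u w : R -> U) (t : R) (v z : W).

Local Notation cint := (conv_integral S B).

Lemma conv_unique u t v z : cint u t v -> cint u t z -> v = z.
Proof.
by move=> /bochner_bint h1 /bochner_bint h2;
  exact: bint_unique (finite_domain_itv 0 t) h1 h2.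
Qed.

Lemma conv_sub u w t v z : cint u t v -> cint w t z ->
  cint (fun s => u s - w s) t (v - z).
Proof.
move=> /bochner_bint h1 /bochner_bint h2; apply/bochner_bint.
rewrite addrC -scaleN1r.
apply: bint_eq (bint_lin (-1) (finite_domain_itv 0 t) h2 h1) => s _.
by rewrite scaleN1r !linearB/= addrC.
Qed.

Lemma conv_ae u w t v :
  {ae mu, forall r : R, 0 <= r <= t -> u r = w r} -> cint u t v -> cint w t v.
Proof.
move=> uw /bochner_bint h; apply/bochner_bint; apply: bint_ae h.
by apply: ae_imp uw => r h /=; rewrite in_itv/= => /h ->.
Qed.

Lemma conv_eq u w t v :
  (forall r : R, 0 <= r <= t -> u r = w r) -> cint u t v -> cint w t v.
Proof. by move=> uw; apply: conv_ae; exact: ae_all. Qed.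

(** The domain is a single point, so every integrand agrees almost everywhere with zero. *)
Lemma conv_at0 u : cint u 0 0.
Proof.
apply/bochner_bint; apply: bint_ae (bint0 _ _).
exists [set 0]; split => //; first exact: lebesgue_measure_set1.
move=> r /= h; apply: contrapT => r0; apply: h; rewrite in_itv/= => r00.
by exfalso; apply: r0; apply/eqP; rewrite eq_le andbC.
Qed.

Lemma conv_zero u t : {ae mu, forall r : R, 0 <= r <= t -> u r = 0} -> cint u t 0.
Proof.
move=> u0; apply/bochner_bint; apply: bint_ae (bint0 _ _).
by apply: ae_imp u0 => r h /=; rewrite in_itv/= => /h ->; rewrite !linear0.
Qed.

Let split_itv (a b c : R) : a <= b <= c ->
  `[a, c]%classic = `[a, b] `|` `[b, c] /\
  mu (`[a, b] `&` `[b, c]) = 0%E.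
Proof.
move=> /andP[ab bc]; split.
  apply/seteqP; split=> r /=; rewrite !in_itv/=.
    by move=> /andP[ar rc]; have [rb|/ltW br] := leP r b; [left|right]; lra.
  by move=> [] /andP[? ?]; lra.
rewrite (_ : _ `&` _ = [set b]); first exact: lebesgue_measure_set1.
apply/seteqP; split=> r /=; rewrite !in_itv/=.
  by move=> [/andP[_ rb] /andP[br _]]; apply/eqP; rewrite eq_le rb.
by move=> ->; rewrite ab bc lexx.
Qed.

(* The variation-of-constants formula restarted at time [t]. *)
Lemma conv_cocycle u t r v z : 0 <= t -> 0 <= r ->
  cint u t v -> cint (fun s => u (t + s)) r z -> cint u (t + r) (S r v + z).
Proof.
case: S0 => cS _ SD _ t0 r0 /bochner_bint h1 /bochner_bint h2.
have [E E0] := @split_itv 0 t (t + r) ltac:(lra).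
apply/bochner_bint; rewrite E; apply: bint_union => //;
  try exact: finite_domain_itv.
- apply: bint_eq (bint_map (finite_domain_itv 0 t) (cS r r0) h1) => s /=.
  rewrite in_itv/= => /andP[s0 st]; rewrite -SD// ?subr_ge0//.
  by congr (S _ _); ring.
- have := bint_shift (- t) (finite_domain_itv 0 r) h2.
  rewrite (_ : _ @^-1` _ = `[t, t + r]%classic).
    apply: bint_eq => s _.
    have -> : t + (s - t) = s by ring.
    by have -> : r - (s - t) = t + r - s by ring.
  by apply/seteqP; split=> s /=; rewrite !in_itv/=; lra.
Qed.

(** The delayed input vanishes before [c], and a translation carries the rest back to time 0. At [c]
    itself its value is [u 0], discarded as a null set. *)
Lemma conv_delay u t c v : 0 <= c <= t ->
  cint (delay c u) t v -> cint u (t - c) v.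
Proof.
move=> ct /bochner_bint h.
have [E E0] := @split_itv 0 c t ct.
rewrite E in h; have [v1 [v2 [h1 h2 ->]]] := bint_restrict
  (finite_domain_itv 0 c) (finite_domain_itv c t) E0 h.
have -> : v1 = 0.
  apply: (bint_unique (finite_domain_itv 0 c) h1).
  apply: bint_ae (bint0 _ _); exists [set c]; split => //.
    exact: lebesgue_measure_set1.
  move=> r /= nh; apply: contrapT => rc; apply: nh; rewrite in_itv/= => /andP[r0 rle].
  rewrite delay_lt ?linear0// lt_neqAle rle andbT.
  by apply/eqP.
rewrite add0r; apply/bochner_bint.
have := bint_shift c (finite_domain_itv c t) h2.
rewrite (_ : _ @^-1` _ = `[0, t - c]%classic).
  apply: bint_eq => s /=; rewrite in_itv/= => /andP[s0 st].
  by rewrite delayE ?lerDr// addrK; congr (S _ _); ring.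
by apply/seteqP; split=> s /=; rewrite !in_itv/=; lra.
Qed.

End Convolution.

(** * Strong continuity *)

Section HalfLineContinuity.
Variables (R : realType) (X : completeNormedModType R).
Implicit Types (x : R -> X).

Definition continuous_nonneg x := forall t, 0 <= t -> forall e : R, 0 < e ->
  exists2 d : R, 0 < d & forall t', 0 <= t' -> `|t' - t| < d ->
    `|x t' - x t| < e.

(** For nonnegative [tau], the nearest-point retraction onto the interval from 0 to [tau]. It
    extends a function continuous there to one continuous on the whole line. *)
Definition clamp (tau s : R) : R := Num.max 0 (Num.min s tau).

Lemma clamp_ge0 (tau s : R) : 0 <= clamp tau s.
Proof. by rewrite le_max lexx. Qed.

Lemma clamp_le (tau s : R) : 0 <= tau -> clamp tau s <= tau.
Proof. by move=> t0; rewrite ge_max t0 ge_min lexx orbT. Qed.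

Lemma clamp_id (tau s : R) : 0 <= s <= tau -> clamp tau s = s.
Proof. by move=> /andP[s0 st]; rewrite /clamp min_l// max_r. Qed.

Lemma clamp_lip (tau s t : R) : `|clamp tau s - clamp tau t| <= `|s - t|.
Proof.
rewrite /clamp /Num.max /Num.min; do ![case: ifPn] => *;
  do ?[match goal with H : is_true (~~ (_ < _)) |- _ =>
         rewrite -leNgt in H end];
  by rewrite ler_norml; apply/andP; split;
     have := ler_norm (s - t); have := ler_norm (t - s); rewrite (distrC t s); lra.
Qed.

Lemma continuousP_eps x : continuous x <-> forall t e, 0 < e ->
  exists2 d : R, 0 < d & forall t', `|t' - t| < d -> `|x t' - x t| < e.
Proof.
split=> [cx t e e0|h t].
  have /cvgrPdist_lt/(_ e e0) := cx t.
  move=> /nbhs_ballP[d d0 hd]; exists d => // t' td.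
  by rewrite distrC; apply: hd; rewrite /ball/= distrC.
apply/cvgrPdist_lt => e e0; have [d d0 hd] := h t e e0.
apply/nbhs_ballP; exists d => // t' /=; rewrite /ball/= distrC => td.
by rewrite distrC; exact: hd.
Qed.

Lemma within_itvP_eps x (tau : R) : {within `[0, tau], continuous x} <->
  forall t, 0 <= t <= tau -> forall e, 0 < e ->
  exists2 d : R, 0 < d & forall t', 0 <= t' <= tau -> `|t' - t| < d ->
    `|x t' - x t| < e.
Proof.
split=> [/subspace_continuousP cx t tt e e0|h].
  have := cx t; rewrite /= in_itv/= => /(_ tt) /cvgrPdist_lt/(_ e e0).
  move=> /nbhs_ballP[d d0 hd]; exists d => // t' t't td.
  rewrite distrC; apply: hd; first by rewrite /ball/= distrC.
  by rewrite /= in_itv.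
apply/subspace_continuousP => t; rewrite /= in_itv/= => tt.
apply/cvgrPdist_lt => e e0; have [d d0 hd] := h t tt e e0.
apply/nbhs_ballP; exists d => // t' /=; rewrite /ball/= distrC => td.
by rewrite in_itv/= => t't; rewrite distrC; exact: hd.
Qed.

Lemma continuous_clamp x (tau : R) : 0 <= tau ->
  {within `[0, tau], continuous x} -> continuous (x \o clamp tau).
Proof.
move=> tau0 /within_itvP_eps cx; apply/continuousP_eps => t e e0.
have ct s : 0 <= clamp tau s <= tau by rewrite clamp_ge0 clamp_le.
have [d d0 hd] := cx _ (ct t) e e0; exists d => // t' td.
by apply: hd => //; exact: le_lt_trans (clamp_lip _ _ _) td.
Qed.

Lemma continuous_within x (tau : R) : continuous x ->
  {within `[0, tau], continuous x}.
Proof. by move=> cx; apply: continuous_subspaceT. Qed.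

Lemma continuous_nonneg_within x (tau : R) : continuous_nonneg x ->
  {within `[0, tau], continuous x}.
Proof.
move=> cx; apply/within_itvP_eps => t /andP[t0 _] e e0.
have [d d0 hd] := cx t t0 e e0; exists d => // t' /andP[t'0 _]; exact: hd.
Qed.

Lemma continuous_nonneg_add x y : continuous_nonneg x -> continuous_nonneg y ->
  continuous_nonneg (fun t => x t + y t).
Proof.
move=> cx cy t t0 e e0; have e2 : 0 < e / 2 by rewrite divr_gt0.
have [d1 d10 h1] := cx t t0 _ e2; have [d2 d20 h2] := cy t t0 _ e2.
exists (Num.min d1 d2); first by rewrite lt_min d10.
move=> t' t'0; rewrite lt_min => /andP[td1 td2].
rewrite opprD addrACA [e]splitr; apply: le_lt_trans (ler_normD _ _) _.
by apply: ltrD; [exact: h1|exact: h2].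
Qed.

End HalfLineContinuity.

Section StrongContinuity.
Variables (R : realType) (X : completeNormedModType R) (T : R -> {linear X -> X}).
Hypothesis T0 : C0_semigroup T.

Lemma semigroup_at0 (x : X) (e : R) : 0 < e ->
  exists2 d : R, 0 < d & forall t, 0 <= t -> t < d -> `|T t x - x| < e.
Proof.
case: T0 => _ Tid _ cT e0; have /cvgrPdist_lt/(_ e e0) := cT x.
rewrite /at_right => /nbhs_ballP[d d0 hd]; exists d => // t.
rewrite le_eqVlt => /predU1P[<- _|t0 td]; first by rewrite Tid subrr normr0.
by rewrite distrC; apply: hd => //; rewrite /ball/= sub0r normrN gtr0_norm.
Qed.

(** Otherwise there are times tending to 0 at which the operators have arbitrarily large norms,
    while strong continuity at 0 keeps their values at each fixed [x] bounded. This contradicts the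
    uniform boundedness principle. *)
Lemma semigroup_bounded_at0 : exists2 d : R, 0 < d &
  exists2 M : R, 0 <= M & forall t x, 0 <= t <= d -> `|T t x| <= M * `|x|.
Proof.
case: T0 => cT Tid _ _; apply: contrapT => no.
have h n : exists tx : R * X, 0 <= tx.1 <= n.+1%:R^-1 /\
    n.+1%:R * `|tx.2| < `|T tx.1 tx.2|.
  apply: contrapT => nh; apply: no; exists n.+1%:R^-1; first by rewrite invr_gt0.
  exists n.+1%:R => // t x tn; rewrite leNgt; apply/negP => tx.
  by apply: nh; exists (t, x).
have {h} [tx htx] := choice h.
pose F : set (X -> X) := range (fun n => T (tx n).1 : X -> X).
have [||M hM] := @Banach_Steinhauss R X X F _ _ 1.
- move=> _ [n _ <-]; split; last exact: linearP.
  have /cT : 0 <= (tx n).1 by have [/andP[]] := htx n.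
  move=> /linear_continuous_bound[M M0 hM] r; exists (M * r) => x xr.
  by apply: le_trans (hM x) _; exact: ler_wpM2l.
- move=> x; have [d d0 hd] := semigroup_at0 x ltr01.
  (* For indices beyond [d^-1] the times lie below [d], where the first two terms suffice; the sum
     handles the finitely many earlier indices. *)
  exists (`|x| + 1 + \sum_(n < (Num.trunc d^-1).+1) `|T (tx n).1 x|).
  move=> _ [n _ <-]; have [nd|dn] := ltnP n (Num.trunc d^-1).+1.
    rewrite (bigD1 (Ordinal nd))//= addrCA lerDl.
    by rewrite addr_ge0// ?addr_ge0// sumr_ge0.
  rewrite -[leLHS]addr0; apply: lerD; last exact: sumr_ge0.
  have [/andP[t0 tn] _] := htx n.
  rewrite -[T _ x](subrK x); apply: le_trans (ler_normD _ _) _.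
  rewrite addrC lerD2l ltW// hd// (le_lt_trans tn)//.
  rewrite invf_plt ?posrE//; apply: lt_le_trans (truncnS_gt _) _.
  by rewrite ler_nat (leq_trans dn).
pose n := (Num.trunc M).+1.
have [_] := htx n; have [->|x0] := eqVneq (tx n).2 0.
  by rewrite linear0 normr0 mulr0 ltxx.
have xp : 0 < `|(tx n).2| by rewrite normr_gt0.
have := hM (T (tx n).1) (ex_intro2 _ _ n I erefl) (`|(tx n).2|^-1 *: (tx n).2).
rewrite normrZ normfV normr_id mulVf ?lt0r_neq0// lexx => /(_ isT).
rewrite linearZ normrZ normfV normr_id ler_pdivrMl// => le1 lt1.
have := lt_le_trans lt1 le1; rewrite mulrC ltr_pM2l// ltNge => /negP; apply.
apply/ltW; apply: lt_trans (truncnS_gt M) _.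
by rewrite ltr_nat.
Qed.

(** The semigroup law propagates the bound near 0 by steps of length [d]. *)
Lemma semigroup_bounded (tau : R) : exists2 M : R, 0 <= M &
  forall t x, 0 <= t <= tau -> `|T t x| <= M * `|x|.
Proof.
have [d d0 [M M0 hM]] := semigroup_bounded_at0; case: T0 => _ _ TD _.
have h n : exists2 M' : R, 0 <= M' &
    forall t x, 0 <= t <= n%:R * d -> `|T t x| <= M' * `|x|.
  elim: n => [|n [M' M'0 hM']].
    exists M => // t x; rewrite mul0r => /andP[t0 t1]; apply: hM.
    by rewrite t0 (le_trans t1)// ltW.
  exists (M + M * M'); first by rewrite addr_ge0// mulr_ge0.
  move=> t x /andP[t0]; rewrite -natr1 mulrDl mul1r => tn; rewrite mulrDl.
  have [td|/ltW dt] := leP t d.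
    rewrite ler_wpDr ?hM ?t0//.
    by rewrite !mulr_ge0.
  rewrite ler_wpDl ?mulr_ge0// (_ : t = d + (t - d)); last by rewrite addrC subrK.
  rewrite TD ?(ltW d0) ?subr_ge0// -mulrA.
  apply: le_trans (hM _ _ _) _; first by rewrite lexx ltW.
  by apply: ler_wpM2l => //; apply: hM'; rewrite subr_ge0 dt lerBlDr.
have [M' M'0 hM'] := h (Num.trunc (tau / d)).+1.
exists M' => // t x /andP[t0 tt]; apply: hM'; rewrite t0 (le_trans tt)//.
by rewrite -ler_pdivrMr// ltW// truncnS_gt.
Qed.

(** The earlier of the two times is the base point: the increment is [T s (T r x - x)], and a bound
    on [T s] uniform up to [t + 1] handles left limits, where the base point moves. *)
Lemma semigroup_continuous (x : X) : continuous_nonneg (fun t => T t x).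
Proof.
move=> t t0 e e0; have [M M0 hM] := semigroup_bounded (t + 1).
case: T0 => _ _ TD _.
have M1 : 0 < M + 1 by rewrite ltr_wpDl.
have [d d0 hd] := semigroup_at0 x (divr_gt0 e0 M1).
exists (Num.min d 1); first by rewrite lt_min d0 ltr01.
have key s r : 0 <= s <= t + 1 -> 0 <= r -> r < d -> `|T (s + r) x - T s x| < e.
  move=> st r0 rd; rewrite TD//; last by case/andP: st.
  rewrite -linearB; apply: le_lt_trans (hM _ _ st) _.
  apply: le_lt_trans (ler_wpM2l M0 (ltW (hd r r0 rd))) _.
  by rewrite mulrCA gtr_pMr// ltr_pdivrMr// mul1r ltrDl.
move=> t' t'0; rewrite lt_min => /andP[td t1].
have [tt'|/ltW t't] := leP t t'.
  have := key t (t' - t); rewrite (_ : t + (t' - t) = t'); last by ring.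
  apply; [lra|by rewrite subr_ge0|].
  exact: le_lt_trans (ler_norm _) td.
rewrite distrC; have := key t' (t - t'); rewrite (_ : t' + (t - t') = t); last by ring.
apply.
- by rewrite t'0 (le_trans t't)// lerDl.
- by rewrite subr_ge0.
- by rewrite distrC in td; exact: le_lt_trans (ler_norm _) td.
Qed.

End StrongContinuity.

(** * Volterra equations *)

Section Volterra.
Variables (R : realType) (X V : completeNormedModType R).
Local Notation mu := (@lebesgue_measure R).
Variables (F : R -> X) (G : R -> (R -> V) -> X) (g : R -> X -> V) (h : R -> R).

Definition nemytskii (x : R -> X) (s : R) : V := g s (x s).

Hypothesis cF : continuous_nonneg F.
Hypothesis cG : forall w, Linf_loc w -> continuous_nonneg (G ^~ w).
Hypothesis G0 : forall t, 0 <= t -> G t (fun=> 0) = 0.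
(** Causality and smallness over short times in one estimate: [t0 = 0] gives the contraction for
    existence, [t0 = k%:R * d] the step for uniqueness. *)
Hypothesis Gdiff : forall (w1 w2 : R -> V) (t0 d t M : R),
  Linf_loc w1 -> Linf_loc w2 ->
  0 <= t0 <= t -> 0 < d -> t <= t0 + d -> 0 <= M ->
  {ae mu, forall r : R, 0 <= r <= t0 -> w1 r = w2 r} ->
  {ae mu, forall r : R, 0 <= r <= t -> `|w1 r - w2 r| <= M} ->
  `|G t w1 - G t w2| <= h d * M.
Hypothesis h0 : forall e, 0 < e -> exists2 d, 0 < d &
  forall d', 0 < d' -> d' <= d -> 0 <= h d' <= e.
Hypothesis gL : forall x, continuous x -> Linf_loc (nemytskii x).
(** The exceptional null set is fixed before [x] and [y], so it serves all functions at once. *)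
Hypothesis glip : forall C : R, exists2 L, 0 < L &
  {ae mu, forall r : R, 0 <= r -> forall x y, `|x| < C -> `|y| < C ->
     `|g r x - g r y| <= L * `|x - y|}.

(** Continuity is asked on the whole line so that [gL] applies; the equation constrains only times
    up to [tau]. *)
Definition volterra_solution (tau : R) (x : R -> X) : Prop :=
  continuous x /\
  forall t, 0 <= t <= tau -> x t = F t + G t (nemytskii x).

Lemma ae_at0 (P : R -> Prop) : {ae mu, forall r : R, 0 <= r <= 0 -> P r}.
Proof.
exists [set 0]; split=> //; first exact: lebesgue_measure_set1.
move=> r /= nh; apply: contrapT => r0; apply: nh => r00.
by exfalso; apply: r0; apply/eqP; rewrite eq_le andbC.
Qed.

Lemma continuous_bounded_itv (x : R -> X) (tau : R) : 0 <= tau ->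
  continuous x -> exists C, forall s, 0 <= s <= tau -> `|x s| < C.
Proof.
move=> tau0 cx.
have [|c _ hc] := @EVT_max R (fun s => `|x s|) 0 tau tau0.
  apply: continuous_subspaceT => s; apply: continuous_comp; first exact: cx.
  exact: norm_continuous.
exists (`|x c| + 1) => s st; rewrite ltr_pwDr//; apply: hc.
by rewrite in_itv.
Qed.

Lemma geometric_small (K : R) (y : R) : (forall n, y <= K * 2^-1 ^+ n) -> y <= 0.
Proof.
move=> hy; have c : K * 2^-1 ^+ n @[n --> \oo] --> K * 0.
  by apply: cvgM; [exact: cvg_cst|apply: cvg_expr; rewrite ger0_norm// invf_lt1// ltr1n].
rewrite mulr0 in c; rewrite -(cvg_lim _ c)//.
by apply: limr_ge; [apply/cvg_ex; exists 0|exact: nearW].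
Qed.

(* A difference vanishing on [0, t0] contracts by 1/2 on a step whose length
   does not depend on t0. *)
Lemma volterra_unique (tau : R) (x y : R -> X) :
  volterra_solution tau x -> volterra_solution tau y ->
  forall s, 0 <= s <= tau -> x s = y s.
Proof.
move=> [cx ex] [cy ey] s0 s0t.
have tau0 : 0 <= tau by case/andP: s0t; exact: le_trans.
have [C1 h1] := continuous_bounded_itv tau0 cx.
have [C2 h2] := continuous_bounded_itv tau0 cy.
pose C := Num.max C1 C2.
have xC s : 0 <= s <= tau -> `|x s| < C by move=> /h1 q; rewrite lt_max q.
have yC s : 0 <= s <= tau -> `|y s| < C by move=> /h2 q; rewrite lt_max q orbT.
have C0 : 0 <= C by apply: ltW; apply: le_lt_trans (xC _ s0t).
have [L L0 hL] := glip C.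
(* This choice makes [h d * L] at most 1/2. *)
have [d d0 hd'] := @h0 (2 * L)^-1 ltac:(by rewrite invr_gt0 mulr_gt0).
have {hd'} /andP[hd0 hd] := hd' d d0 (lexx d).
suff H k : forall s, 0 <= s <= tau -> s <= k%:R * d -> x s = y s.
  apply: (H (Num.trunc (s0 / d)).+1) => //.
  by rewrite -ler_pdivrMr// ltW// truncnS_gt.
elim: k => [s /andP[s_0 st]|k IH].
  rewrite mul0r => s0'; have -> : s = 0 by apply/eqP; rewrite eq_le s0'.
  apply/eqP; rewrite -subr_eq0 -normr_le0 ex ?lexx// ey ?lexx// opprD addrACA subrr add0r.
  have := @Gdiff _ _ 0 d 0 0 (gL cx) (gL cy) _ d0 _ (lexx _)
    (@ae_at0 _) (@ae_at0 _).
  by rewrite mulr0; apply; rewrite ?lexx// add0r ltW.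
move=> s /andP[s_0 st] sk.
have kd0 : 0 <= k%:R * d by rewrite mulr_ge0// ltW.
have [sk'|/ltW ks] := leP s (k%:R * d); first by apply: IH => //; rewrite s_0.
apply/eqP; rewrite -subr_eq0 -normr_le0.
(* From the crude bound [2 * C], each use of the contraction halves the bound on the whole step;
   this iteration replaces a supremum of the difference. *)
apply: (@geometric_small (2 * C)) => n.
have : 0 <= s <= tau by rewrite s_0.
elim: n s {s_0 st} sk ks => [s _ _ st|n IHn s sk ks /andP[s_0 st]].
  rewrite expr0 mulr1 mulr_natl mulr2n; apply: le_trans (ler_normB _ _) _.
  by apply: lerD; apply: ltW; [exact: xC|exact: yC].
rewrite ex ?s_0// ey ?s_0// opprD addrACA subrr add0r.
have K0 : 0 <= 2 * C * 2^-1 ^+ n by rewrite !mulr_ge0// exprn_ge0.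
apply: le_trans (@Gdiff _ _ (k%:R * d) d s (L * (2 * C * 2^-1 ^+ n))
  (gL cx) (gL cy) _ d0 _ _ _ _) _.
- by rewrite kd0.
- by move: sk; rewrite -natr1 mulrDl mul1r.
- by rewrite mulr_ge0// ltW.
- apply: ae_all => r /andP[r0 rk]; rewrite /nemytskii IH// r0 (le_trans rk)//.
  exact: le_trans ks st.
- apply: ae_imp hL => r lip /andP[r0 rs].
  have rt : 0 <= r <= tau by rewrite r0 (le_trans rs).
  apply: le_trans (lip r0 _ _ (xC _ rt) (yC _ rt)) _.
  apply: ler_wpM2l; first exact: ltW.
  have [rk|/ltW kr] := leP r (k%:R * d); first by rewrite IH// subrr normr0.
  by apply: IHn => //; exact: le_trans rs sk.
- rewrite exprS [leRHS]mulrCA [leLHS]mulrA; apply: ler_wpM2r => //.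
  apply: le_trans (ler_wpM2r (ltW L0) hd) _.
  by rewrite invfM -mulrA mulVf ?mulr1// lt0r_neq0.
Qed.

Definition picard (tau : R) (y : R -> X) (s : R) : X :=
  F (clamp tau s) + G (clamp tau s) (nemytskii y).

Lemma volterra_exists : exists2 tau, 0 < tau & exists x, volterra_solution tau x.
Proof.
pose x0 := F 0.
have cst_x0 : continuous ((fun=> x0) : R -> X) by move=> ?; exact: cvg_cst.
have L0oo : Linf_loc (fun=> 0 : V).
  apply: Linf_loc_eq (Linf_loc_sub (gL cst_x0) (gL cst_x0)) => r _.
  by rewrite subrr.
have /Linf_norm_bound[M M0 xM] := (gL cst_x0).2 1 ler01.
(* The iterates stay within 1 of [x0]; the second unit makes the norm bound strict. *)
pose C := `|x0| + 2; have [L L0 lip] := glip C.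
(* [L + M] bounds [g r y] for [y] within 1 of [x0], for almost every [r] up to time 1. The factor 2
   leaves half of the unit radius to the variation of [F]. *)
have K0 : 0 < 2 * (L + M) by rewrite mulr_gt0// ltr_pwDl.
have [d1 d10 hd1] := @h0 (2 * (L + M))^-1 ltac:(by rewrite invr_gt0).
have [d2 d20 hd2] := @cF 0 (lexx 0) 2^-1 ltac:(by rewrite invr_gt0).
(* Times up to 1 are those where [M] is valid; halving [d2] gives the strict inequality [d < d2]. *)
pose d := Num.min 1 (Num.min d1 (d2 / 2)).
have d0 : 0 < d by rewrite !lt_min ltr01 d10 divr_gt0.
have dd1 : d <= d1 by rewrite !ge_min lexx !orbT.
have dd2 : d < d2 by rewrite !gt_min ltr_pdivrMr// ltr_pMr// ltr1n !orbT.
have dle1 : d <= 1 by rewrite ge_min lexx.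
have /andP[hd hdK] := hd1 d d0 dd1.
have hdLM : h d * (L + M) <= 2^-1.
  apply: le_trans (ler_wpM2r (ltW _) hdK) _; first by rewrite ltr_pwDl.
  by rewrite invfM -mulrA mulVf ?mulr1// lt0r_neq0// ltr_pwDl.
have hdL : h d * L <= 2^-1.
  by apply: le_trans hdLM; apply: ler_wpM2l => //; rewrite lerDl.
have ct s : 0 <= clamp d s <= d by rewrite clamp_ge0 clamp_le// ltW.
(* The invariant ball can be stated on the whole line because the clamp freezes [picard] outside the
   interval from 0 to [d]. *)
pose P (y : R -> X) := continuous y /\ forall s, `|y s - x0| <= 1.
have PC y s : P y -> `|y s| < C.
  move=> [_ /(_ s) y1]; rewrite -[y s](subrK x0).
  by apply: le_lt_trans (ler_normD _ _) _; rewrite addrC ltrD2l; lra.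
have Pcontr y z (m : R) : 0 <= m -> P y -> P z -> (forall s, `|y s - z s| <= m) ->
    forall s, `|picard d y s - picard d z s| <= 2^-1 * m.
  move=> m0 Py Pz yz s; rewrite /picard opprD addrACA subrr add0r.
  apply: le_trans (@Gdiff _ _ 0 d _ (L * m) (gL Py.1) (gL Pz.1) _ d0 _ _
    (@ae_at0 _) _) _.
  - by rewrite lexx clamp_ge0.
  - by rewrite add0r; case/andP: (ct s).
  - by rewrite mulr_ge0// ltW.
  - apply: ae_imp lip => r l /andP[r0 _].
    apply: le_trans (l r0 _ _ (PC _ _ Py) (PC _ _ Pz)) _.
    by apply: ler_wpM2l => //; exact: ltW.
  - by rewrite mulrA; exact: ler_wpM2r.
have Pcont y : continuous y -> continuous (picard d y).
  move=> cy; apply: (@continuous_clamp _ _ (fun s => F s + G s (nemytskii y))).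
    exact: ltW.
  apply: continuous_nonneg_within; apply: continuous_nonneg_add => //.
  by apply: cG; exact: gL.
have Px0 : P (fun=> x0) by split=> // s; rewrite subrr normr0.
have PP y : P y -> P (picard d y).
  move=> Py; split=> [|s]; first exact: Pcont Py.1.
  rewrite /picard addrAC; apply: le_trans (ler_normD _ _) _.
  rewrite [leRHS](splitr 1) !mul1r; apply: lerD.
    apply/ltW/hd2; first exact: clamp_ge0.
    rewrite subr0 ger0_norm ?clamp_ge0//; apply: le_lt_trans dd2.
    by case/andP: (ct s).
  rewrite -[G _ _]subr0 -(G0 (clamp_ge0 d s)).
  apply: le_trans (@Gdiff _ _ 0 d _ (L + M) (gL Py.1) L0oo _ d0 _ _
    (@ae_at0 _) _) hdLM.
  - by rewrite lexx clamp_ge0.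
  - by rewrite add0r; case/andP: (ct s).
  - by rewrite addr_ge0// ltW.
  - apply: ae_imp2 lip xM => r l xr /andP[r0 rs]; rewrite subr0.
    rewrite -[nemytskii y r](subrK (g r x0)); apply: le_trans (ler_normD _ _) _.
    apply: lerD; last first.
      apply: xr; rewrite /= in_itv/= r0 (le_trans rs)//.
      by apply: le_trans dle1; case/andP: (ct s).
    apply: le_trans (l r0 _ _ (PC _ _ Py) (PC _ r Px0)) _.
    rewrite -[leRHS]mulr1; apply: ler_wpM2l; first exact: ltW.
    exact: Py.2.
pose y n := iter n (picard d) (fun=> x0).
have Py n : P (y n) by elim: n => [//|n IH] /=; exact: PP.
have ystep n s : `|y n.+1 s - y n s| <= 2^-1 ^+ n.
  elim: n s => [s|n IH s]; first by rewrite expr0; exact: (PP _ Px0).2.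
  rewrite exprS; apply: (Pcontr _ _ _ _ (Py n.+1) (Py n) IH).
  by rewrite exprn_ge0.
have ydist n k s : `|y (n + k)%N s - y n s| <= 2 * 2^-1 ^+ n.
  (* Keeping the exact tail of the geometric series lets the induction on [k] close. *)
  suff : `|y (n + k)%N s - y n s| <= 2 * 2^-1 ^+ n - 2 * 2^-1 ^+ (n + k).
    by move=> /le_trans; apply; rewrite gerBl mulr_ge0// exprn_ge0.
  elim: k => [|k IH]; first by rewrite addn0 !subrr normr0.
  have := ystep (n + k)%N s; rewrite addnS exprS.
  have := ler_distD (y (n + k)%N s) (y (n + k).+1 s) (y n s).
  move: IH; set q := 2^-1 ^+ (n + k); set p := 2^-1 ^+ n; lra.
have small (e : R) : 0 < e -> exists n : nat, 2 * 2^-1 ^+ n < e.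
  move=> e0; apply: contrapT => no; have : e <= 0; last by rewrite leNgt e0.
  apply: (@geometric_small 2) => n; rewrite leNgt; apply/negP => ne.
  by apply: no; exists n.
have ylim s : exists z : X, y n s @[n --> \oo] --> z.
  apply: cauchy_seq_cvg => e e0.
  have [N hN] := small (e / 2) ltac:(by rewrite divr_gt0).
  exists N => n m Nn Nm; rewrite [e]splitr.
  apply: le_trans (ler_distD (y N s) _ _) _; apply: lerD.
    by rewrite -(subnKC Nn) (le_trans (ydist _ _ _))// ltW.
  by rewrite distrC -(subnKC Nm) (le_trans (ydist _ _ _))// ltW.
have [z hz] := choice ylim.
have zy n s : `|z s - y n s| <= 2 * 2^-1 ^+ n.
  apply: (@cvg_seq_norm_le _ _ (fun k => y k s - y n s)).
    by apply: cvgB; [exact: hz|exact: cvg_cst].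
  by exists n => k nk; rewrite -(subnKC nk).
have cz : continuous z.
  apply/continuousP_eps => t e e0.
  have [n hn] := small (e / 4) ltac:(by rewrite divr_gt0).
  have /continuousP_eps/(_ t (e / 4) ltac:(by rewrite divr_gt0)) := (Py n).1.
  move=> [r r0 hr]; exists r => // t' /hr tt'.
  have := zy n t; have := zy n t'; have := ler_distD (y n t') (z t') (z t).
  have := ler_distD (y n t) (y n t') (z t); rewrite (distrC (y n t)).
  by lra.
have Pz : P z.
  split=> // s; apply: (@cvg_seq_norm_le _ _ (fun k => y k s - x0)).
    by apply: cvgB; [exact: hz|exact: cvg_cst].
  by exists 0%N => k _; exact: (Py k).2.
exists d => //; exists z; split=> // t td.
apply/eqP; rewrite -subr_eq0 -normr_le0.
have -> : F t + G t (nemytskii z) = picard d z t by rewrite /picard clamp_id.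
(* Both [z] and [picard d z] are within [2^-1 ^+ n] of the iterate [y n.+1]: the first by the limit
   estimate, the second by contraction. *)
apply: (@geometric_small 2) => n.
apply: le_trans (ler_distD (y n.+1 t) _ _) _.
have q0 : 0 <= 2 * 2^-1 ^+ n :> R by rewrite mulr_ge0 ?exprn_ge0.
have := zy n.+1 t; have := Pcontr _ _ _ q0 Pz (Py n) (zy n) t.
rewrite (distrC (picard d z t)) -[picard d (y n) t]/(y n.+1 t) exprS.
set q := 2^-1 ^+ n; lra.
Qed.

End Volterra.

(** * Maximal solutions *)

Lemma ereal_real_between (R : realType) (x y : \bar R) :
  (0 <= x)%E -> (x < y)%E ->
  exists2 r : R, (x < r%:E)%E & (r%:E < y)%E.
Proof.
case: x => [x| |] //; case: y => [y| |] // _.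
- by rewrite lte_fin => xy; exists ((x + y) / 2); rewrite lte_fin; lra.
- by move=> _; exists (x + 1); [rewrite lte_fin ltrDl|exact: ltry].
Qed.

Section Maximal.
Variables (R : realType) (X : completeNormedModType R)
  (P : R -> (R -> X) -> Prop).
Hypothesis P_eq : forall tau x y, (forall s, 0 <= s <= tau -> x s = y s) ->
  P tau x -> P tau y.
Hypothesis P_le : forall tau tau' x, 0 < tau' <= tau -> P tau x -> P tau' x.
Hypothesis P_unique : forall tau x y, 0 < tau -> P tau x -> P tau y ->
  forall s, 0 <= s <= tau -> x s = y s.
Hypothesis P_exists : exists2 tau, 0 < tau & exists x, P tau x.

Definition solution_before (t1 : \bar R) (x : R -> X) : Prop :=
  (0 < t1)%E /\ forall tau : R, 0 < tau -> (tau%:E < t1)%E -> P tau x.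

Definition maximal_solution (t1 : \bar R) (x1 : R -> X) : Prop :=
  solution_before t1 x1 /\
  ~ exists t2 x2, solution_before t2 x2 /\ extends t1 x1 t2 x2.

(** No solution outlives [tm], since a real strictly between [tm] and a longer lifetime would belong
    to [S]. So nothing extends [phi], while [phi] would extend any solution with a smaller
    lifetime. *)
Lemma maximal_solution_exists_unique : exists (tm : \bar R) (phi : R -> X),
  [/\ (0 < tm)%E, maximal_solution tm phi &
      forall tm' phi', maximal_solution tm' phi' ->
        tm' = tm /\ forall s : R, 0 <= s -> (s%:E < tm)%E -> phi' s = phi s].
Proof.
pose S := [set tau%:E | tau in [set tau | 0 < tau /\ exists x, P tau x]].
pose tm := ereal_sup S.
have Stm tau x : 0 < tau -> P tau x -> (tau%:E <= tm)%E.
  by move=> t0 Px; apply: ereal_sup_ubound; exists tau => //; split=> //; exists x.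
have tmS (s : R) : (s%:E < tm)%E -> exists tau x, [/\ s < tau, 0 < tau & P tau x].
  move=> /ereal_sup_gt[_ [tau [t0 [x Px]] <-]]; rewrite lte_fin => st.
  by exists tau, x.
have tm0 : (0 < tm)%E.
  have [tau t0 [x Px]] := P_exists; apply: lt_le_trans (Stm _ _ t0 Px).
  by rewrite lte_fin.
have [x0 _] : exists x0 : X, True.
  by have [tau t0 [x Px]] := P_exists; exists (x 0).
(* The value comes from some solution living strictly beyond [s]; [agree] makes the choice
   immaterial at nonnegative times. The default [x0] serves only times from [tm] on. *)
have /choice[phi hphi] (s : R) : exists y, (s%:E < tm)%E ->
    exists tau x, [/\ s < tau, 0 < tau, P tau x & y = x s].
  have [/tmS[tau [x [st t0 Px]]]|] := boolP (s%:E < tm)%E.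
    by exists (x s) => _; exists tau, x.
  by exists x0.
have agree tau tau' x y s : 0 < tau -> 0 < tau' -> P tau x -> P tau' y ->
    0 <= s -> s <= tau -> s <= tau' -> x s = y s.
  move=> t0 t'0 Px Py s0 st st'; pose m := Num.min tau tau'.
  have m0 : 0 < m by rewrite lt_min t0.
  have Pmx : P m x by apply: P_le Px; rewrite m0 ge_min lexx.
  have Pmy : P m y by apply: P_le Py; rewrite m0 ge_min lexx orbT.
  by apply: (P_unique m0 Pmx Pmy); rewrite s0 le_min st.
have solphi : solution_before tm phi.
  split=> // tau t0 ttm; have [tau' [x [tt' t'0 Px]]] := tmS _ ttm.
  apply: (@P_eq _ x); last by apply: P_le Px; rewrite t0 ltW.
  move=> s /andP[s0 st].
  have [|tau2 [y [sy t20 Py ->]]] := hphi s.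
    by apply: le_lt_trans ttm; rewrite lee_fin.
  apply: (agree _ _ _ _ _ t'0 t20 Px Py s0); last exact: ltW.
  exact: le_trans st (ltW tt').
have le_tm t x : solution_before t x -> (t <= tm)%E.
  move=> [t0 hx]; rewrite leNgt; apply/negP => tmt.
  have [r rtm rt] := ereal_real_between (ltW tm0) tmt.
  have r0 : 0 < r by rewrite -lte_fin (lt_trans tm0).
  by have := Stm _ _ r0 (hx _ r0 rt); rewrite leNgt rtm.
have eq_phi t x s : solution_before t x -> 0 <= s -> (s%:E < t)%E -> phi s = x s.
  move=> sx s0 st; have [tau stau taut] := ereal_real_between (x := s%:E) s0 st.
  have t0 : 0 < tau by rewrite -lte_fin (le_lt_trans _ stau)// lee_fin.
  apply: (P_unique t0 _ (sx.2 _ t0 taut)).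
    by apply: solphi.2 => //; apply: lt_le_trans taut (le_tm _ _ sx).
  by rewrite s0 -lee_fin ltW.
exists tm, phi; split=> //.
  split=> // -[t2 [x2 [sx2 [tt2 _]]]].
  by have := le_tm _ _ sx2; rewrite leNgt tt2.
move=> tm' phi' [sphi' max'].
have tm'E : tm' = tm.
  apply/eqP; rewrite eq_le (le_tm _ _ sphi')/= leNgt; apply/negP => lt.
  apply: max'; exists tm, phi; split=> //; split=> // s s0 st.
  exact: eq_phi sphi' s0 st.
split=> // s s0; rewrite -{1}tm'E => st.
exact/esym/(eq_phi _ _ _ sphi' s0 st).
Qed.

End Maximal.

(** * Mild solutions *)

(** The norm of [iota x] is that of [Ra x], and [Ra] is undone by applying [a - A]. *)
Lemma extrapolation_injective (R : realType) (X Xm1 : completeNormedModType R)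
    (D : set X) (A : X -> X) (a : R) (iota : {linear X -> Xm1}) :
  is_extrapolation_space D A a iota -> injective iota.
Proof.
move=> [Ra [_ RaA _] [normi _]].
have i0 x : iota x = 0 -> x = 0.
  move=> /(congr1 Num.norm); rewrite normi normr0 => /normr0_eq0 Rx0.
  (* [A] is a bare function, so [x] is compared with 0 through [Ra 0 = 0] and not through linearity
     of [A]. *)
  by rewrite -(RaA x).2 -(RaA 0).2 Rx0 linear0.
move=> x y xy; apply/eqP; rewrite -subr_eq0; apply/eqP/i0.
by rewrite linearB xy subrr.
Qed.

Section MildSolutions.
Variables (R : realType) (X Xm1 : completeNormedModType R).
Local Notation mu := (@lebesgue_measure R).
Variables (iota : {linear X -> Xm1}) (T : R -> {linear X -> X})
  (Tm1 : R -> {linear Xm1 -> Xm1}).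
Hypothesis iotaI : injective iota.
Hypothesis T0 : C0_semigroup T.
Hypothesis extT : is_extrapolated_semigroup iota T Tm1.

Section InputMap.
Variables (W : completeNormedModType R) (B : {linear W -> Xm1}).
Local Notation cint := (conv_integral Tm1 B).
Local Notation Phi := (Phi iota Tm1 B).
Implicit Types (w : R -> W).

Definition conv_in_X := forall t w, 0 <= t -> Linf_loc w ->
  exists x : X, cint w t (iota x).

(** Reduces an identity for [Phi] to exhibiting an integral, whatever [xget] selects. *)
Lemma Phi_unique t w x : cint w t (iota x) -> Phi t w = x.
Proof.
move=> h; have := @xgetPex _ 0 [set x | cint w t (iota x)] (ex_intro _ x h).
by move=> /= h'; apply: iotaI; exact: conv_unique h' h.
Qed.

Lemma conv_Phi t w : conv_in_X -> 0 <= t -> Linf_loc w ->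
  cint w t (iota (Phi t w)).
Proof. by move=> ex t0 lw; have [x h] := ex t w t0 lw; rewrite (Phi_unique h). Qed.

Lemma conv_cocycle_iota w t r x z : 0 <= t -> 0 <= r ->
  cint w t (iota x) -> cint (fun s => w (t + s)) r (iota z) ->
  cint w (t + r) (iota (T r x + z)).
Proof.
case: extT => T0m TT t0 r0 h1 h2.
by rewrite linearD -TT//; exact: conv_cocycle.
Qed.

(** For [t] up to [t1], delaying the input by [t1 - t] makes its integral over the full length [t1]
    the wanted one. For longer times a final stretch of length [t1] is split off by the cocycle
    identity. *)
Lemma admissible_conv_in_X : admissible iota Tm1 B -> conv_in_X.
Proof.
move=> [t1 t10 h1].
suff H n t w : 0 <= t -> t <= n.+1%:R * t1 -> Linf_loc w ->
    exists x : X, cint w t (iota x).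
  move=> t w t0; apply: (H (Num.trunc (t / t1)) t w t0).
  by rewrite -ler_pdivrMr// ltW// truncnS_gt.
elim: n t w => [|n IH] t w t0 tn lw.
  rewrite mul1r in tn.
  have [x hx] := h1 _ (Linf_loc_delay (t1 - t) lw); exists x.
  have := @conv_delay _ _ _ Tm1 B w t1 (t1 - t) _ _ hx.
  by rewrite subKr; apply; rewrite subr_ge0 tn gerBl.
have [tt1|/ltW t1t] := leP t t1.
  by apply: IH => //; apply: le_trans tt1 _; rewrite ler_peMl ?ler1n// ltW.
have [||x hx] := IH (t - t1) w _ _ lw; first by rewrite subr_ge0.
  by rewrite lerBlDr; move: tn; rewrite -natr1 mulrDl mul1r.
have [|y hy] := h1 (fun s => w (t - t1 + s)).
  by apply: Linf_loc_shift => //; rewrite subr_ge0.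
exists (T t1 x + y); rewrite -[t](subrK t1).
by apply: conv_cocycle_iota => //; [rewrite subr_ge0|exact: ltW].
Qed.

Section ZeroClass.
Variable h : R -> R.
Hypothesis h_gt0 : forall t, 0 < t -> 0 < h t.
Hypothesis h_le : forall s t, 0 < s -> s <= t -> h s <= h t.
Hypothesis h_bound : forall t w, 0 < t -> Linf_loc w ->
  exists2 x : X, cint w t (iota x) &
    (`|x|%:E <= (h t)%:E * Linf_norm `[0%R, t] w)%E.
Hypothesis h_cvg0 : h t @[t --> 0^'+] --> 0.

Lemma h_small e : 0 < e -> exists2 d, 0 < d &
  forall d', 0 < d' -> d' <= d -> 0 <= h d' <= e.
Proof.
move=> e0; have /cvgrPdist_lt/(_ e e0) := h_cvg0.
rewrite /at_right => /nbhs_ballP[d d0 hd]; exists (d / 2); first by rewrite divr_gt0.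
move=> d' d'0 d'd; rewrite ltW ?h_gt0//=.
have := hd d'; rewrite /ball/= !sub0r !normrN !gtr0_norm ?h_gt0// => H.
by apply/ltW/H => //; apply: le_lt_trans d'd _; rewrite ltr_pdivrMr// ltr_pMr// ltr1n.
Qed.

Lemma zero_class_conv_in_X : conv_in_X.
Proof.
move=> t w; rewrite le_eqVlt => /predU1P[<- _|t0 lw].
  by exists 0; rewrite linear0; exact: conv_at0.
by have [x hx _] := h_bound t0 lw; exists x.
Qed.

(** Monotonicity of [h] replaces [t] by a fixed step [d]. Time 0 is separate because [h] is
    controlled only at positive times. *)
Lemma Phi_bound t d M w : 0 <= t <= d -> 0 < d -> 0 <= M -> Linf_loc w ->
  {ae mu, forall r : R, 0 <= r <= t -> `|w r| <= M} -> `|Phi t w| <= h d * M.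
Proof.
move=> /andP[]; rewrite le_eqVlt => /predU1P[<- _|t0 td] d0 M0 lw wM.
  rewrite (@Phi_unique 0 w 0); last by rewrite linear0; exact: conv_at0.
  by rewrite normr0 mulr_ge0// ltW// h_gt0.
have [x hx] := h_bound t0 lw; rewrite (Phi_unique hx) => xb.
apply: le_trans (ler_wpM2r M0 (h_le t0 td)); rewrite -lee_fin EFinM.
apply: le_trans xb _; apply: lee_wpmul2l; first by rewrite lee_fin ltW// h_gt0.
exact/Linf_norm_leP.
Qed.

Lemma Phi_sub t w1 w2 : 0 <= t -> Linf_loc w1 -> Linf_loc w2 ->
  Phi t (fun s => w1 s - w2 s) = Phi t w1 - Phi t w2.
Proof.
move=> t0 l1 l2; apply: Phi_unique; rewrite linearB.
by apply: conv_sub; exact: (conv_Phi zero_class_conv_in_X).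
Qed.

Lemma Phi_cocycle t s w : 0 <= t -> 0 <= s -> Linf_loc w ->
  Phi (t + s) w = T s (Phi t w) + Phi s (fun r => w (t + r)).
Proof.
move=> t0 s0 lw; apply: Phi_unique; apply: conv_cocycle_iota => //.
  exact: (conv_Phi zero_class_conv_in_X).
by apply: (conv_Phi zero_class_conv_in_X) => //; exact: Linf_loc_shift.
Qed.

Lemma ae_shift_itv (c t : R) (Q : R -> Prop) : 0 <= c ->
  {ae mu, forall r : R, 0 <= r <= c + t -> Q r} ->
  {ae mu, forall r : R, 0 <= r <= t -> Q (c + r)}.
Proof.
move=> c0 /(ae_shift c); apply: ae_imp => r q /andP[r0 rt].
by rewrite addrC; apply: q; rewrite addr_ge0//= addrC lerD2l.
Qed.

Lemma Phi_diff (w1 w2 : R -> W) (t0 d t M : R) :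
  Linf_loc w1 -> Linf_loc w2 ->
  0 <= t0 <= t -> 0 < d -> t <= t0 + d -> 0 <= M ->
  {ae mu, forall r : R, 0 <= r <= t0 -> w1 r = w2 r} ->
  {ae mu, forall r : R, 0 <= r <= t -> `|w1 r - w2 r| <= M} ->
  `|Phi t w1 - Phi t w2| <= h d * M.
Proof.
move=> l1 l2 /andP[t00 t0t] d0 td M0 w12 wM.
have lw := Linf_loc_sub l1 l2.
have tt0 : 0 <= t - t0 by rewrite subr_ge0.
rewrite -Phi_sub ?(le_trans t00)// -(subrKC t0 t) Phi_cocycle//.
rewrite (@Phi_unique t0 _ 0); last first.
  rewrite linear0; apply: conv_zero; apply: ae_imp w12 => r e /e ->.
  by rewrite subrr.
rewrite linear0 add0r; apply: Phi_bound => //.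
- by rewrite tt0 lerBlDl.
- exact: (Linf_loc_shift t00 lw).
- apply: (@ae_shift_itv t0 _ (fun r => `|w1 r - w2 r| <= M)) => //.
  by rewrite subrKC.
Qed.

(* On [t1, t1 + d] the map [s |-> Phi s w] is within [h d * M] of
   [s |-> T (s - t1) (Phi t1 w)]; taking t1 slightly smaller than t handles
   both one-sided limits at t. *)
Lemma Phi_continuous_nonneg w : Linf_loc w -> continuous_nonneg (Phi ^~ w).
Proof.
move=> lw t t0 e e0.
have t10 : 0 <= t + 1 by rewrite addr_ge0.
have /Linf_norm_bound[M M0 wM] := lw.2 _ t10.
(* A quarter of [e] goes to each of two integral terms and a half to the orbit; [M + 1] avoids
   division by zero. *)
have K0 : 0 < 4 * (M + 1) by rewrite mulr_gt0// ltr_wpDl.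
have [d' d'0 hd'] := h_small (divr_gt0 e0 K0).
pose d := Num.min d' 1.
have d0 : 0 < d by rewrite lt_min d'0 ltr01.
have d1 : d <= 1 by rewrite ge_min lexx orbT.
have /andP[hd0 hd] : 0 <= h d <= e / (4 * (M + 1)).
  by apply: hd' => //; rewrite ge_min lexx.
have hdM : h d * M <= e / 4.
  apply: le_trans (ler_wpM2r M0 hd) _.
  rewrite invfM mulrA -[leLHS]mulrA; apply: ler_piMr; first by rewrite divr_ge0// ltW.
  by rewrite mulrC ler_pdivrMr ?mul1r ?lerDl// ltr_wpDl.
(* [t1] does not depend on the nearby time [s], so a single orbit serves for all of them; from [t1]
   to [t + d / 2] the length is at most [d]. *)
pose t1 := Num.max 0 (t - d / 2).
have t1_ge0 : 0 <= t1 by rewrite le_max lexx.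
have t1t : t1 <= t by rewrite ge_max t0 gerBl divr_ge0// ltW.
have tt1 : t - d / 2 <= t1 by rewrite le_max lexx orbT.
have near s : t1 <= s -> s <= t + d / 2 ->
    `|Phi s w - T (s - t1) (Phi t1 w)| <= e / 4.
  move=> t1s std; rewrite -{1}(subrKC t1 s) Phi_cocycle ?subr_ge0//.
  rewrite addrC addKr; apply: le_trans hdM; apply: Phi_bound => //.
  - by rewrite subr_ge0 t1s; lra.
  - exact: Linf_loc_shift.
  - apply: (@ae_shift_itv t1 _ (fun r => `|w r| <= M)) => //.
    apply: ae_imp wM => r wr; rewrite subrKC => /andP[r0 rs]; apply: wr.
    by rewrite /= in_itv/= r0; lra.
have e2 : 0 < e / 2 by rewrite divr_gt0.
have tt1_ge0 : 0 <= t - t1 by rewrite subr_ge0.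
have [c c0 hc] := semigroup_continuous T0 (Phi t1 w) tt1_ge0 e2.
exists (Num.min c (d / 2)); first by rewrite lt_min c0 divr_gt0.
move=> s s0; rewrite lt_min => /andP[sc sd].
have := ler_norm (s - t); have := ler_norm (t - s); rewrite (distrC t s) => a1 a2.
have t1s : t1 <= s by rewrite ge_max s0; lra.
have b1 := near s t1s ltac:(lra).
have b2 := near t t1t ltac:(lra).
have b3 : `|T (s - t1) (Phi t1 w) - T (t - t1) (Phi t1 w)| < e / 2.
  apply: hc; first by rewrite subr_ge0.
  by rewrite (_ : s - t1 - (t - t1) = s - t)//; ring.
have := ler_distD (T (s - t1) (Phi t1 w)) (Phi s w) (Phi t w).
have := ler_distD (T (t - t1) (Phi t1 w)) (T (s - t1) (Phi t1 w)) (Phi t w).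
rewrite (distrC (T (t - t1) (Phi t1 w)) (Phi t w)); lra.
Qed.

End ZeroClass.

End InputMap.

(** * Mild solutions as solutions of a Volterra equation in [X] *)

Section System.
Variables (U V : completeNormedModType R) (B : {linear U -> Xm1})
  (B2 : {linear V -> Xm1}) (f : X -> U -> V) (x0 : X) (u : R -> U).
Hypothesis exB : conv_in_X B.
Hypothesis exB2 : conv_in_X B2.
Hypothesis lu : Linf_loc u.
Hypothesis lf : forall x : R -> X, continuous x -> Linf_loc (fun s => f (x s) (u s)).

Local Notation mild := (mild_solution_on iota T Tm1 B B2 f x0 u).
Local Notation F := (fun t => T t x0 + Phi iota Tm1 B t u).
Local Notation G := (Phi iota Tm1 B2).
Local Notation g := (fun s x => f x (u s)).

(** The clamp supplies global continuity and leaves the input unchanged on the domain of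
    integration; injectivity of [iota] brings the equation down to [X]. *)
Lemma mild_volterra tau x : 0 <= tau -> mild tau x ->
  volterra_solution F G g tau (x \o clamp tau).
Proof.
move=> tau0 [cx hx]; have cc := continuous_clamp tau0 cx; split=> // t tt.
have [t0 t_tau] := andP tt.
have [v2 [v [h2 h E]]] := hx t tt; apply: iotaI.
rewrite /= clamp_id// E !linearD -!addrA; congr (_ + _); rewrite addrC.
congr (_ + _); first by apply: conv_unique h _; exact: conv_Phi.
apply: (conv_unique (conv_eq _ h2)); last by apply: conv_Phi => //; exact: lf.
by move=> s /andP[s0 st] /=; rewrite /nemytskii /= clamp_id// s0 (le_trans st).
Qed.

Lemma volterra_mild tau x : volterra_solution F G g tau x -> mild tau x.
Proof.
move=> [cx hx]; split; first exact: continuous_within.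
move=> t tt; have [t0 t_tau] := andP tt.
exists (iota (G t (nemytskii g x))), (iota (Phi iota Tm1 B t u)); split.
- by apply: conv_Phi => //; exact: lf.
- exact: conv_Phi.
- by rewrite hx// !linearD addrAC.
Qed.

Lemma mild_eq tau x y : (forall s, 0 <= s <= tau -> x s = y s) ->
  mild tau x -> mild tau y.
Proof.
move=> xy [cx hx]; split.
  apply/within_itvP_eps => t tt e e0.
  have /within_itvP_eps/(_ t tt e e0)[d d0 hd] := cx.
  by exists d => // t' t't' td; rewrite -!xy//; exact: hd.
move=> t tt; have [t0 t_tau] := andP tt; have [v2 [v [h2 h E]]] := hx t tt.
exists v2, v; split=> //; last by rewrite -xy.
apply: conv_eq h2 => s /andP[s0 st] /=; rewrite xy// s0 (le_trans st)//.
Qed.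

Lemma mild_le tau tau' x : 0 < tau' <= tau -> mild tau x -> mild tau' x.
Proof.
move=> /andP[_ le] [cx hx]; split.
  apply/within_itvP_eps => t /andP[t0 tt] e e0.
  have /within_itvP_eps/(_ t _ e e0)[|d d0 hd] := cx.
    by rewrite t0 (le_trans tt).
  exists d => // t' /andP[t'0 t't] td; apply: hd => //.
  by rewrite t'0 (le_trans t't).
by move=> t /andP[t0 tt]; apply: hx; rewrite t0 (le_trans tt).
Qed.

End System.

End MildSolutions.

Theorem theorem3p17 (R : realType) (X U V : completeNormedModType R)
  (D : set X) (A : X -> X) (T : R -> {linear X -> X})
  (genA : generates D A T)
  (Xm1 : completeNormedModType R) (iota : {linear X -> Xm1}) (a : R)
  (extX : is_extrapolation_space D A a iota)
  (Tm1 : R -> {linear Xm1 -> Xm1})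
  (extT : is_extrapolated_semigroup iota T Tm1)
  (B : {linear U -> Xm1}) (contB : continuous B)
  (B2 : {linear V -> Xm1}) (contB2 : continuous B2)
  (f : X -> U -> V)
  (admB : admissible iota Tm1 B)
  (contPhi : Phi_continuous iota Tm1 B)
  (admB2 : zero_class_admissible iota Tm1 B2)
  (measf : forall (u : R -> U) (x : R -> X),
     Linf u -> {within `[0, +oo[, continuous x} ->
     Linf_loc (fun s => f (x s) (u s)))
  (lipf : forall C : R, 0 < C -> exists2 L : R, 0 < L &
     forall (x y : X) (v : U), `|x| < C -> `|y| < C -> `|v| < C ->
       `|f y v - f x v| <= L * `|y - x|)
  (contf : forall x : X, continuous (f x))
  (boundf : exists (sigma : R -> R) (c : R),
     [/\ Kinfty sigma, 0 < c & forall v : U, `|f 0 v| <= sigma `|v| + c]) :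
  well_posed iota T Tm1 B B2 f.
Proof.
move=> x0 u Lu; have iotaI := extrapolation_injective extX.
have T0 : C0_semigroup T := genA.1.
have exB := admissible_conv_in_X extT admB.
have lu := Linf_Linf_loc Lu.
have lf (x : R -> X) : continuous x -> Linf_loc (fun s => f (x s) (u s)).
  by move=> cx; apply: measf => //; apply: continuous_subspaceT.
have [h [h_gt0 h_le h_bound h_cvg0]] := admB2.
have exB2 := zero_class_conv_in_X h_bound.
pose F t := T t x0 + Phi iota Tm1 B t u.
pose G := Phi iota Tm1 B2.
pose g s x := f x (u s).
have cF : continuous_nonneg F.
  apply: continuous_nonneg_add; first exact: semigroup_continuous.
  move=> t t0 e e0; have [d d0 hd] := contPhi t u t0 Lu e e0.
  exists d => // t' t'0 td; apply: hd => //.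
  (* Only the time varies, so the two inputs coincide and their difference has norm at most zero. *)
  apply: (@le_lt_trans _ _ 0%:E); last by rewrite lte_fin.
  apply/Linf_norm_leP => //; apply: ae_all => r _.
  by rewrite /= subrr normr0.
have cG w : Linf_loc w -> continuous_nonneg (G ^~ w).
  exact: (Phi_continuous_nonneg iotaI T0 extT h_gt0 h_le h_bound h_cvg0).
have G0 t : 0 <= t -> G t (fun=> 0) = 0.
  move=> t0; apply: (Phi_unique iotaI); rewrite linear0.
  by apply: conv_zero; exact: ae_all.
have Gdiff := @Phi_diff _ _ _ _ _ _ iotaI extT _ _ _ h_gt0 h_le h_bound.
have hs := h_small h_gt0 h_cvg0.
have glip (C : R) : exists2 L, 0 < L & {ae @lebesgue_measure R, forall r : R,
    0 <= r -> forall x y, `|x| < C -> `|y| < C -> `|g r x - g r y| <= L * `|x - y|}.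
  have [_ /Linf_norm_bound[M M0 uM]] := Lu.
  (* The Lipschitz hypothesis uses one radius for states and inputs, so it is enlarged beyond the
     essential bound [M] of [u]. *)
  have C0 : 0 < Num.max C (M + 1) by rewrite lt_max ltr_wpDl ?orbT.
  have [L L0 hL] := lipf _ C0; exists L => //.
  apply: ae_imp uM => r ur r0 x y xC yC; apply: hL; rewrite lt_max ?xC ?yC//.
  apply/orP; right; apply: (@le_lt_trans _ _ M); last by rewrite ltrDl.
  by apply: ur; rewrite /= in_itv/= r0.
apply: maximal_solution_exists_unique.
- by move=> tau x y; exact: mild_eq.
- by move=> tau tau' x; exact: mild_le.
- move=> tau x y tau0 mx my s st.
  have vx := mild_volterra iotaI exB exB2 lu lf (ltW tau0) mx.
  have vy := mild_volterra iotaI exB exB2 lu lf (ltW tau0) my.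
  have := volterra_unique Gdiff hs lf glip vx vy st.
  by rewrite /= clamp_id.
- have [tau tau0 [x vx]] := volterra_exists cF cG G0 Gdiff hs lf glip.
  by exists tau => //; exists x; apply: volterra_mild vx.
Qed.
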